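(* Let $g,r,d$ and ramification sequences $\alpha,\beta$ satisfy $\rho(g,r,d,\alpha,\beta)=0$, $r\ge2$ and $\alpha_r+\beta_r+g-d+r>r+1$, and let $N=|YT(g,r,d,\alpha,\beta)|$. Suppose moreover that: (1) $\max\{\alpha_0-\alpha_r,1\}<\min_{0\le j<r}\{\alpha_{r-j-1}+\beta_j\}+g-d$; (2) $\sum_{i=0}^r(\alpha_i-\alpha_r)<\alpha_r+g-d+r+\beta_r$; (3) for every $0\le i<r$, $\alpha_{r-i}+\beta_i-1<\min_{i\le j<r}\{\alpha_{r-i-j-1}+\beta_j\}$ (minimum over those $j$ with $r-i-j-1\in\{0,\dots,r\}$; empty minimum $=+\infty$); (4) for every $0<i<r$, $\alpha_{r-i}+\beta_i=\alpha_{r-1}+\beta_1\ge\alpha_r+\beta_0$. Then the EH group, as a subgroup of the symmetric group on $YT(g,r,d,\alpha,\beta)$, is either the alternating group $A_N$ or the full symmetric group $S_N$.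
   Context: Ramification sequences: $\alpha=(\alpha_0,\dots,\alpha_r)$ integers with $d-r\ge\alpha_0\ge\cdots\ge\alpha_r\ge0$, $|\alpha|=\sum\alpha_i$; $g-d+r\ge0$; $\rho(g,r,d,\alpha,\beta)=g-(r+1)(g-d+r)-|\alpha|-|\beta|$. Skew diagram $\sigma(g,r,d,\alpha,\beta)$ (with $m=g-d+r$): rows $k=1,\dots,r+1$ numbered top to bottom, row $k$ consisting of boxes $(k,c)$ with $\alpha_0-\alpha_{r+1-k}<c\le\alpha_0+m+\beta_{k-1}$ (columns numbered left to right); it has $g$ boxes when $\rho=0$. $YT(g,r,d,\alpha,\beta)$ is the set of standard Young tableaux of this shape: bijective fillings with $1,\dots,g$ strictly increasing along rows (left to right) and columns (top to bottom). The distance between boxes $(i,j),(i',j')$ is $|i-i'|+|j-j'|$. For $1\le t<g$ and $a>0$, $\pi_{t,a}$ is the permutation of $YT(g,r,d,\alpha,\beta)$ exchanging the entries $t$ and $t+1$ in every tableau where they lie in different rows and different columns at distance exactly $a$, and fixing all other tableaux. The EH group is the subgroup of the symmetric group on $YT(g,r,d,\alpha,\beta)$ generated by all $\pi_{t,a}$. *)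

(* Defs.v *)
From HB Require Import structures.
From mathcomp Require Import all_boot all_order all_algebra all_fingroup all_solvable.
Set Implicit Arguments. Unset Strict Implicit. Unset Printing Implicit Defensive.
Import GRing.Theory Num.Theory.

(* Ramification sequences alpha = (alpha_0,...,alpha_r) are given as functions
   nat -> nat; only the values at 0..r are ever used. *)

Definition wt (r : nat) (alpha : nat -> nat) : nat := \sum_(i < r.+1) alpha i.

Definition rho (g r d : nat) (alpha beta : nat -> nat) : int :=
  (g%:Z - (r%:Z + 1) * (g%:Z - d%:Z + r%:Z) - (wt r alpha)%:Z - (wt r beta)%:Z)%R.

Definition ram_seq (r d : nat) (alpha : nat -> nat) : Prop :=
  r <= d /\ alpha 0 <= d - r /\ (forall i, i < r -> alpha i.+1 <= alpha i).

(* m = g - d + r (as a nat; the hypothesis g - d + r >= 0 is imposed separately) *)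
Definition mm (g r d : nat) : nat := g + r - d.

(* bounds for the rows/columns in which the skew diagram lives *)
Definition nrows (r : nat) : nat := r.+2.
Definition ncols (g r d : nat) (alpha beta : nat -> nat) : nat :=
  (alpha 0 + mm g r d + beta 0).+1.

Definition inshape (g r d : nat) (alpha beta : nat -> nat) (k c : nat) : bool :=
  (1 <= k <= r.+1) &&
  (alpha 0 - alpha (r.+1 - k) < c <= alpha 0 + mm g r d + beta k.-1).

Definition boxT g r d (alpha beta : nat -> nat) : finType :=
  ('I_(nrows r) * 'I_(ncols g r d alpha beta))%type.

Definition isbox g r d alpha beta (p : boxT g r d alpha beta) : bool :=
  inshape g r d alpha beta p.1 p.2.

(* A filling: entry of each box (entries 1..g, value 0 on non-boxes). *)
Definition filling g r d alpha beta : finType :=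
  {ffun boxT g r d alpha beta -> 'I_g.+1}.

Definition standardb g r d alpha beta (T : filling g r d alpha beta) : bool :=
  [&& [forall p, ~~ isbox p ==> (T p == 0 :> nat)],
      [forall p, isbox p ==> (0 < T p)],
      [forall p, forall q, (isbox p && isbox q && (T p == T q)) ==> (p == q)],
      [forall e : 'I_g.+1, (0 < e) ==> [exists p, isbox p && (T p == e)]],
      [forall p, forall q, (isbox p && isbox q && (p.1 == q.1 :> nat)
                              && (p.2 < q.2)) ==> (T p < T q)] &
      [forall p, forall q, (isbox p && isbox q && (p.2 == q.2 :> nat)
                              && (p.1 < q.1)) ==> (T p < T q)]].

Definition YT g r d alpha beta : finType :=
  {T : filling g r d alpha beta | standardb T}.

Definition distn' (i j i' j' : nat) : nat := (i - i') + (i' - i) + ((j - j') + (j' - j)).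

Definition swap_cond g r d alpha beta (t a : nat) (T : filling g r d alpha beta) : bool :=
  [exists p, exists q,
    [&& isbox p, isbox q, T p == t :> nat, T q == t.+1 :> nat,
        p.1 != q.1 :> nat, p.2 != q.2 :> nat & distn' p.1 p.2 q.1 q.2 == a]].

Definition swap_entries g r d alpha beta (t : nat) (T : filling g r d alpha beta)
  : filling g r d alpha beta :=
  [ffun p => if T p == t :> nat then inord t.+1
             else if T p == t.+1 :> nat then inord t else T p].

Definition is_pi g r d alpha beta (t a : nat) (s : {perm YT g r d alpha beta}) : bool :=
  [forall T : YT g r d alpha beta,
     val (s T) == (if swap_cond t a (val T) then swap_entries t (val T) else val T)].

(* Generators pi_{t,a}, 1 <= t < g, a > 0 (any a larger than every possible
   distance gives the identity, so bounding a by nrows + ncols loses nothing). *)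
Definition EH_gens g r d alpha beta : {set {perm YT g r d alpha beta}} :=
  [set s | [exists t : 'I_g, exists a : 'I_(nrows r + ncols g r d alpha beta),
              [&& 0 < (t : nat), 0 < (a : nat) & is_pi t a s]]].

Definition EH g r d alpha beta : {set {perm YT g r d alpha beta}} :=
  <<EH_gens g r d alpha beta>>%g.

(* Main.v *)
(* Reading the entries 1, ..., g in order turns a tableau into a word: a linear extension
   of the skew diagram, ordered by "weakly north-west of".  Two consecutive letters are
   either adjacent boxes or an incomparable pair, and then their distance is the absolute
   difference of their contents (column minus row).  So pi_{t,a} exchanges the letters
   number t and t+1 exactly when their contents differ by a, for all a > 1.

   We follow an increasing chain of order ideals K and show that the group contains every
   even permutation of the linear extensions of K, acting on the words that begin with
   one of them and leaving the other words fixed.  If v can be added to K, the commutator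
   of such a 3-cycle with some pi_{#|K|,a} is a 3-cycle for K + v, provided that a singles
   out v: one of the three prefixes ends in a corner l with |l - v| = a, where no other
   addable box has distance a from l, and the other two end in a corner which has no
   addable box at distance a.  For l we take the end p of the top row, the box of
   largest content.  The chain starts from the top row with the first boxes of the two
   leftmost columns below it: two prescribed consecutive distances force the first
   entries of the tableau, because the diagram has more than r+1 full columns.  Then the
   columns are filled one after the other, from left to right.  The one place where this
   fails is a rectangular ideal which becomes symmetric under reflection by adding v; it
   is bypassed by adding v before the last box of the rectangle. *)
Require Import Defs.
From HB Require Import structures.
From mathcomp Require Import all_boot all_order all_algebra all_fingroup all_solvable.
From mathcomp Require Import zify.
Import GRing.Theory Num.Theory.
Set Implicit Arguments. Unset Strict Implicit. Unset Printing Implicit Defensive.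

(** * Words and prefixes *)

Section Seqs.
Context (B : finType) (c : B -> int).
Implicit Types (x y : B) (s p q w : seq B).

Definition cdist x y : nat := `|(c x - c y)%R|.

(** Positions count from 0, so for $a>1$ this is the action of $\pi_{t+1,a}$ on the words of
    tableaux: consecutive letters that are adjacent boxes have distance 1, so a larger distance
    already means an incomparable pair. *)
Definition swap_at (t a : nat) s : seq B :=
  if drop t s is x :: y :: s' then
    if cdist x y == a then take t s ++ y :: x :: s' else s
  else s.

Definition rot3 p1 p2 p3 q : seq B :=
  if q == p1 then p2 else if q == p2 then p3 else if q == p3 then p1 else q.

Definition on_prefix (j : nat) (f : seq B -> seq B) w := f (take j w) ++ drop j w.

Definition size_preserving (f : seq B -> seq B) := forall s, size (f s) = size s.

Lemma cdistC x y : cdist x y = cdist y x.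
Proof. by rewrite /cdist -abszN opprB. Qed.

Lemma swap_at_cat s1 x y s2 a :
  swap_at (size s1) a (s1 ++ x :: y :: s2) =
  if cdist x y == a then s1 ++ y :: x :: s2 else s1 ++ x :: y :: s2.
Proof. by rewrite /swap_at drop_size_cat // take_size_cat. Qed.

Variant swap_at_spec (t a : nat) s : seq B -> Prop :=
  | SwapAtIn s1 x y s2 of size s1 = t & s = s1 ++ x :: y :: s2 & cdist x y = a :
      swap_at_spec t a s (s1 ++ y :: x :: s2)
  | SwapAtFar s1 x y s2 of size s1 = t & s = s1 ++ x :: y :: s2 & cdist x y != a :
      swap_at_spec t a s s
  | SwapAtOut of size s <= t.+1 : swap_at_spec t a s s.

Lemma swap_atP t a s : swap_at_spec t a s (swap_at t a s).
Proof.
rewrite /swap_at; case E: (drop t s) => [|x [|y s']].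
- apply: SwapAtOut; have := size_drop t s; rewrite E /=; lia.
- apply: SwapAtOut; have := size_drop t s; rewrite E /=; lia.
have Es : s = take t s ++ x :: y :: s' by rewrite -E cat_take_drop.
have st : size (take t s) = t.
  by rewrite size_takel //; have := size_drop t s; rewrite E /=; lia.
by case: eqP => [e|/eqP e]; [apply: SwapAtIn Es e|apply: SwapAtFar Es e].
Qed.

Lemma swap_at_small t a s : size s <= t.+1 -> swap_at t a s = s.
Proof.
by case: (swap_atP t a s) => // s1 x y s2 <- -> _; rewrite size_cat /=; lia.
Qed.

Lemma swap_atK t a : involutive (swap_at t a).
Proof.
move=> s; case: {2}(swap_atP t a s) => [s1 x y s2 <- -> e|s1 x y s2 <- -> ne|/swap_at_small-> //].
  by rewrite swap_at_cat cdistC e eqxx.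
by rewrite !swap_at_cat (negbTE ne).
Qed.

Lemma size_swap_at t a : size_preserving (swap_at t a).
Proof.
by move=> s; case: (swap_atP t a s) => // s1 x y s2 _ -> _; rewrite !size_cat.
Qed.

Lemma on_prefix_swap_at j t a : t.+1 < j -> on_prefix j (swap_at t a) =1 swap_at t a.
Proof.
move=> tj s; rewrite /on_prefix.
case: (swap_atP t a (take j s)) => [s1 x y s2 <- e d|s1 x y s2 <- e d|].
- have Es : s = s1 ++ x :: y :: (s2 ++ drop j s) by rewrite -{1}(cat_take_drop j s) e -catA.
  by rewrite [in RHS]Es swap_at_cat d eqxx -catA.
- have Es : s = s1 ++ x :: y :: (s2 ++ drop j s) by rewrite -{1}(cat_take_drop j s) e -catA.
  by rewrite cat_take_drop [in RHS]Es swap_at_cat (negbTE d).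
- rewrite cat_take_drop => st; rewrite swap_at_small //.
  by move: st; rewrite size_take; case: ifP; lia.
Qed.

Lemma take_on_prefix j f w : size_preserving f ->
  take j (on_prefix j f w) = f (take j w).
Proof.
move=> sf; rewrite /on_prefix; have [h|h] := leqP j (size w).
  by rewrite take_size_cat // sf size_takel.
by rewrite drop_oversize ?(ltnW h) // cats0 take_oversize // sf size_take_min geq_minl.
Qed.

Lemma drop_on_prefix j f w : size_preserving f ->
  drop j (on_prefix j f w) = drop j w.
Proof.
move=> sf; rewrite /on_prefix; have [h|h] := leqP j (size w).
  by rewrite drop_size_cat // sf size_takel.
rewrite (drop_oversize (ltnW h)) cats0 drop_oversize //.
by rewrite sf size_take_min geq_minl.
Qed.

Lemma on_prefix_comp j f g w : size_preserving f ->
  on_prefix j g (on_prefix j f w) = on_prefix j (g \o f) w.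
Proof.
by move=> sf; rewrite {1}/on_prefix take_on_prefix // drop_on_prefix.
Qed.

Lemma on_prefixS j f w : on_prefix j.+1 (on_prefix j f) w = on_prefix j f w.
Proof.
rewrite /on_prefix take_takel // -catA; congr (_ ++ _).
by rewrite -[RHS](cat_take_drop 1) take_drop drop_drop add1n.
Qed.

Lemma size_on_prefix j f : size_preserving f -> size_preserving (on_prefix j f).
Proof. by move=> sf w; rewrite /on_prefix size_cat sf -size_cat cat_take_drop. Qed.

Lemma rot3_1 p1 p2 p3 : rot3 p1 p2 p3 p1 = p2.
Proof. by rewrite /rot3 eqxx. Qed.

Lemma rot3_2 p1 p2 p3 : p1 != p2 -> rot3 p1 p2 p3 p2 = p3.
Proof. by rewrite /rot3 eqxx eq_sym => /negbTE->. Qed.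

Lemma rot3_3 p1 p2 p3 : p1 != p3 -> p2 != p3 -> rot3 p1 p2 p3 p3 = p1.
Proof. by rewrite /rot3 eqxx !(eq_sym p3) => /negbTE-> /negbTE->. Qed.

Lemma rot3_id p1 p2 p3 q : q != p1 -> q != p2 -> q != p3 -> rot3 p1 p2 p3 q = q.
Proof. by rewrite /rot3 => /negbTE-> /negbTE-> /negbTE->. Qed.

Lemma rot3K p1 p2 p3 : uniq [:: p1; p2; p3] -> cancel (rot3 p1 p2 p3) (rot3 p1 p3 p2).
Proof.
rewrite /= !inE !negb_or andbT => /andP[/andP[n12 n13] n23] q.
have n32 : p3 != p2 by rewrite eq_sym.
have [->|q1] := eqVneq q p1; first by rewrite rot3_1 rot3_3.
have [->|q2] := eqVneq q p2; first by rewrite rot3_2 // rot3_2.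
have [->|q3] := eqVneq q p3; first by rewrite rot3_3 // rot3_1.
by rewrite !rot3_id.
Qed.

Lemma rot3_rot p1 p2 p3 : uniq [:: p1; p2; p3] -> rot3 p1 p2 p3 =1 rot3 p2 p3 p1.
Proof.
rewrite /= !inE !negb_or andbT => /andP[/andP[n12 n13] n23] q; rewrite /rot3.
have [->|q1] := eqVneq q p1; first by rewrite (negbTE n12) (negbTE n13).
by [].
Qed.

Lemma size_rot3 p1 p2 p3 : size p2 = size p1 -> size p3 = size p1 ->
  size_preserving (rot3 p1 p2 p3).
Proof.
move=> s2 s3 q; rewrite /rot3.
by case: eqP => [->//|_]; case: eqP => [->|_]; [rewrite s3|case: eqP => [->|]].
Qed.

Lemma rot3_conj f g p1 p2 p3 : cancel f g -> cancel g f ->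
  f \o rot3 p1 p2 p3 \o g =1 rot3 (f p1) (f p2) (f p3).
Proof.
move=> fg gf q; rewrite /rot3 /= !(can2_eq gf fg).
by case: ifP => // _; case: ifP => // _; case: ifP.
Qed.

End Seqs.

(** The commutator of two permutations whose supports meet in one point is a 3-cycle. Here the
    common support [E] may be larger, but neither permutation maps a point of [E] into [E], so the
    commutator is a product of disjoint 3-cycles, one through each point of [E]. *)
Lemma commutator_rot3 (X : finType) (u h : {perm X}) (E : pred X)
    (w := (u^-1 * h^-1 * u * h)%g) :
  (forall T, E T = (u T != T) && (h T != T)) ->
  (forall T, E T -> ~~ E (u T) && ~~ E (h T)) ->
  (forall T, E T -> [/\ w T = h T, w (h T) = u T & w (u T) = T]) /\
  (forall T, ~~ E T -> (forall S, E S -> T != u S /\ T != h S) -> w T = T).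
Proof.
move=> Edef Eout.
have Wd T : w T = h (u ((h^-1)%g ((u^-1)%g T))) by rewrite /w !permM.
have fixV (s : {perm X}) T : s T = T -> (s^-1)%g T = T.
  by move=> e; rewrite -{1}e permK.
have movV (s : {perm X}) T : (s ((s^-1)%g T) != (s^-1)%g T) = (s T != T).
  by rewrite permKV -(can2_eq (permK s) (permKV s)).
have movS (s : {perm X}) T : (s (s T) != s T) = (s T != T).
  by rewrite (inj_eq perm_inj).
have hfix T : ~~ E T -> u T != T -> h T = T.
  by rewrite Edef => nE uT; move: nE; rewrite uT /= => /negPn/eqP.
have ufix T : ~~ E T -> h T != T -> u T = T.
  by rewrite Edef => nE hT; move: nE; rewrite hT andbT => /negPn/eqP.
split=> [T ET|T nET nim].
  have /andP[uT hT] : (u T != T) && (h T != T) by rewrite -Edef.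
  have /andP[nEu nEh] := Eout T ET.
  (* The images and preimages of [T] under [u] and [h] lie outside [E], hence each is moved by only
     one of the two permutations. *)
  have nEuV : ~~ E ((u^-1)%g T).
    by apply/negP => /Eout; rewrite permKV ET.
  have nEhV : ~~ E ((h^-1)%g T).
    by apply/negP => /Eout; rewrite permKV ET andbF.
  have hz : h ((u^-1)%g T) = (u^-1)%g T by apply: hfix nEuV _; rewrite movV.
  have uz : u ((h^-1)%g T) = (h^-1)%g T by apply: ufix nEhV _; rewrite movV.
  have uh : u (h T) = h T by apply: ufix nEh _; rewrite movS.
  have hu : h (u T) = u T by apply: hfix nEu _; rewrite movS.
  split; rewrite Wd.
  - by rewrite (fixV _ _ hz) permKV.
  - by rewrite (fixV _ _ uh) permK hu.
  - by rewrite permK uz permKV.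
rewrite Wd; have nEz : ~~ E ((u^-1)%g T).
  by apply/negP => /nim[/eqP]; rewrite permKV.
have nEw : ~~ E ((h^-1)%g T).
  by apply/negP => /nim[_ /eqP]; rewrite permKV.
have [uT|uT] := eqVneq (u T) T.
  rewrite (fixV _ _ uT); have [hT|hT] := eqVneq (h T) T.
    by rewrite (fixV _ _ hT) uT hT.
  by rewrite (ufix _ nEw) ?movV // permKV.
by rewrite (fixV h) ?permKV ?hfix // movV.
Qed.

(** * Three-cycles of prefixes realised in the group *)

Section Prefixes.
Context (B : finType) (c : B -> int) (X : finType) (G : {group {perm X}}).
Context (word : X -> seq B) (word_inj : injective word).
Implicit Types (p q s w : seq B) (f g : seq B -> seq B).

Definition acts_on_prefix j f :=
  exists2 u, u \in G & forall T, word (u T) = on_prefix j f (word T).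

(* Three words of length [j] are rotated by an element of [G] which acts on tableaux only
   through their first [j] entries, whatever the remaining entries are. *)
Definition three_cycle j p1 p2 p3 :=
  [/\ all (fun p => size p == j) [:: p1; p2; p3], uniq [:: p1; p2; p3]
    & acts_on_prefix j (rot3 p1 p2 p3)].

Definition linked j p q := p = q \/ exists x, three_cycle j p q x.

(** Being [linked] turns out to be an equivalence relation, and a class with at least three members
    carries all of its 3-cycles. *)
Lemma acts_on_prefix_ext j f g : f =1 g -> acts_on_prefix j f -> acts_on_prefix j g.
Proof. by move=> fg [u uG Hu]; exists u => // T; rewrite Hu /on_prefix fg. Qed.

Lemma acts_on_prefix_comp j f g :
  size_preserving f -> acts_on_prefix j f -> acts_on_prefix j g -> acts_on_prefix j (g \o f).
Proof.
move=> sf [u uG Hu] [v vG Hv]; exists (u * v)%g; first exact: groupM.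
by move=> T; rewrite permM Hv Hu on_prefix_comp.
Qed.

Lemma acts_on_prefix_inv j f g : size_preserving f -> cancel f g -> acts_on_prefix j f -> acts_on_prefix j g.
Proof.
move=> sf fg [u uG Hu]; exists (u^-1)%g; first by rewrite groupV.
move=> T; set S := (u^-1)%g T; have -> : T = u S by rewrite permKV.
by rewrite Hu /on_prefix -/(on_prefix j f (word S)) take_on_prefix // drop_on_prefix // fg cat_take_drop.
Qed.

Lemma acts_on_prefixS j f : acts_on_prefix j f -> acts_on_prefix j.+1 (on_prefix j f).
Proof. by case=> u uG Hu; exists u => // T; rewrite Hu on_prefixS. Qed.

Lemma three_cycle_size j p1 p2 p3 : three_cycle j p1 p2 p3 -> [/\ size p1 = j, size p2 = j & size p3 = j].
Proof. by case=> /and4P[/eqP-> /eqP-> /eqP->]. Qed.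

Lemma three_cycle_size_preserving j p1 p2 p3 : three_cycle j p1 p2 p3 -> size_preserving (rot3 p1 p2 p3).
Proof. by case/three_cycle_size=> s1 s2 s3; apply: size_rot3; rewrite ?s2 ?s3 s1. Qed.

Lemma three_cycle_rot j p1 p2 p3 : three_cycle j p1 p2 p3 -> three_cycle j p2 p3 p1.
Proof.
case=> sz un act; split.
- by move: sz => /= /and4P[-> -> -> _].
- by rewrite -(rot_uniq 1) in un.
- by apply: acts_on_prefix_ext act; apply: rot3_rot.
Qed.

Lemma three_cycle_inv j p1 p2 p3 : three_cycle j p1 p2 p3 -> three_cycle j p1 p3 p2.
Proof.
move=> H; case: (H) => sz un act; split.
- by move: sz => /= /and4P[-> -> -> _].
- by move: un; rewrite /= !inE !negb_or !andbT (eq_sym p2 p3) => /andP[/andP[-> ->] ->].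
- exact: acts_on_prefix_inv (three_cycle_size_preserving H) (rot3K un) act.
Qed.

Lemma three_cycle_swap j p1 p2 p3 : three_cycle j p1 p2 p3 -> three_cycle j p2 p1 p3.
Proof. by move/three_cycle_inv/three_cycle_rot/three_cycle_rot. Qed.

Lemma three_cycle_act j f g p1 p2 p3 : acts_on_prefix j f -> size_preserving f -> cancel f g -> cancel g f ->
  three_cycle j p1 p2 p3 -> three_cycle j (f p1) (f p2) (f p3).
Proof.
move=> af sf fg gf H; case: (H) => sz un act; split.
- by move: sz; rewrite /= !sf.
- by move: un; rewrite /= !inE !(can_eq fg).
have sg : size_preserving g by move=> s; rewrite -{2}(gf s) sf.
apply: (acts_on_prefix_ext (rot3_conj p1 p2 p3 fg gf)); apply: acts_on_prefix_comp => //.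
  exact: acts_on_prefix_inv sf fg af.
by apply: acts_on_prefix_comp => //; apply: three_cycle_size_preserving H.
Qed.

Lemma three_cycle_conj j p1 p2 p3 q1 q2 q3 (f := rot3 q1 q2 q3) :
  three_cycle j q1 q2 q3 -> three_cycle j p1 p2 p3 -> three_cycle j (f p1) (f p2) (f p3).
Proof.
move=> Hq; case: (Hq) => _ unq actq; apply: three_cycle_act => //.
- exact: three_cycle_size_preserving Hq.
- exact: rot3K.
- by apply: rot3K; case: (three_cycle_inv Hq).
Qed.

Lemma linked_sym j p q : linked j p q -> linked j q p.
Proof. by case=> [->|[x /three_cycle_swap Hx]]; [left|right; exists x]. Qed.

Lemma three_cycle_neq j p1 p2 p3 : three_cycle j p1 p2 p3 -> [/\ p1 != p2, p1 != p3 & p2 != p3].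
Proof. by case=> _; rewrite /= !inE !negb_or andbT => /andP[/andP[-> ->] ->]. Qed.

(** Conjugating the cycle through [p] and [q] by a cycle that sends [q] to [r] and fixes [p] gives a
    cycle through [p] and [r]. Coincidences among the points are treated first. *)
Lemma linked_trans j q p r : linked j p q -> linked j q r -> linked j p r.
Proof.
case=> [->//|[x Hx]] [<-|[y Hy]]; first by right; exists x.
have [pq px qx] := three_cycle_neq Hx; have [qr qy ry] := three_cycle_neq Hy.
have [<-|xr] := eqVneq x r; first by right; exists q; apply: three_cycle_inv.
have [<-|yp] := eqVneq y p; first by right; exists q; apply/three_cycle_swap/three_cycle_rot.
have [<-|pr] := eqVneq p r; first by left.
right; exists (rot3 q r y x).
have -> : p = rot3 q r y p.
  by rewrite rot3_id // eq_sym.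
by rewrite -{2}(rot3_1 q r y); apply: three_cycle_conj.
Qed.

Lemma linked_act j f g p q : acts_on_prefix j f -> size_preserving f -> cancel f g -> cancel g f ->
  linked j p q -> linked j (f p) (f q).
Proof. by move=> af sf fg gf [->|[x Hx]]; [left|right; exists (f x); apply: three_cycle_act fg gf Hx]. Qed.

(** The cycle linking [p] and [q] has a third point [x], which is linked to [r]. Conjugation by a
    cycle through [x] and [r] replaces [x] by [r]; if that cycle also meets [p] or [q], conjugation
    by its inverse gives the wanted cycle up to rotation and inversion. *)
Lemma linked_C3 j p q r : uniq [:: p; q; r] -> linked j p q -> linked j q r -> three_cycle j p q r.
Proof.
rewrite /= !inE !negb_or andbT => /andP[/andP[pq pr] qr].
move=> Lpq Lqr; case: (Lpq) => [/eqP|[x Hx]]; first by rewrite (negbTE pq).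
have [<-//|xr] := eqVneq x r.
have : linked j x r.
  by apply: linked_trans Lqr; right; exists p; apply/three_cycle_swap/three_cycle_rot.
case=> [/eqP|[z Hz]]; first by rewrite (negbTE xr).
have [_ px qx] := three_cycle_neq Hx; have [_ xz rz] := three_cycle_neq Hz.
have [zp|zp] := eqVneq z p.
  rewrite zp in Hz; have := three_cycle_conj (three_cycle_inv Hz) Hx.
  rewrite rot3_1 rot3_2 1?eq_sym // rot3_id // 1?eq_sym // => H.
  exact: three_cycle_rot (three_cycle_inv H).
have [zq|zq] := eqVneq z q.
  rewrite zq in Hz; have := three_cycle_conj (three_cycle_inv Hz) Hx.
  rewrite rot3_1 rot3_2 1?eq_sym // rot3_id // 1?eq_sym // => H.
  exact: three_cycle_inv H.
have := three_cycle_conj Hz Hx; rewrite rot3_1 !rot3_id // 1?eq_sym //.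
Qed.

(** This is [commutator_rot3] with [E] the tableaux whose word begins with [q1]. The conditions on
    continuations make every word beginning with [q2] or [q3] the image of one beginning with [q1],
    so the rotation is the same whatever follows the prefix. *)
Lemma three_cycle_commutator j q1 q2 q3 (u h : {perm X}) :
  all (fun p => size p == j) [:: q1; q2; q3] -> uniq [:: q1; q2; q3] ->
  u \in G -> h \in G ->
  (forall T s, word T = q1 ++ s -> word (u T) = q3 ++ s /\ word (h T) = q2 ++ s) ->
  (forall s, (exists T, word T = q2 ++ s) -> exists T, word T = q1 ++ s) ->
  (forall s, (exists T, word T = q3 ++ s) -> exists T, word T = q1 ++ s) ->
  (forall T, u T != T -> h T != T -> exists s, word T = q1 ++ s) ->
  three_cycle j q1 q2 q3.
Proof.
move=> sz un uG hG Huh H2 H3 HE; split => //.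
have [s1 s2 s3] : [/\ size q1 = j, size q2 = j & size q3 = j].
  by move: sz => /= /and4P[/eqP-> /eqP-> /eqP->].
have [n12 n13 n23] : [/\ q1 != q2, q1 != q3 & q2 != q3].
  by move: un; rewrite /= !inE !negb_or andbT => /andP[/andP[-> ->] ->].
pose E := [pred T | take j (word T) == q1].
have EP T : E T -> exists s, word T = q1 ++ s.
  by move=> /eqP e; exists (drop j (word T)); rewrite -e cat_take_drop.
have take_q q s : size q = j -> take j (q ++ s) = q by move=> <-; rewrite take_size_cat.
have drop_q q s : size q = j -> drop j (q ++ s) = s by move=> <-; rewrite drop_size_cat.
have PE T s : word T = q1 ++ s -> E T by move=> e; rewrite /E /= e take_q.
have cat_neq q q' s : size q = j -> size q' = j -> q != q' -> q ++ s != q' ++ s.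
  by move=> sq sq' /negP nq; apply/negP; rewrite eqseq_cat ?sq ?sq' // => /andP[].
have Edef T : E T = (u T != T) && (h T != T).
  apply/idP/andP => [/EP[s e]|[uT hT]]; last by have [s /PE] := HE _ uT hT.
  have [eu eh] := Huh _ _ e.
  split; apply/eqP => /(congr1 word)/eqP; rewrite e ?eu ?eh; apply/negP.
    by apply: cat_neq; rewrite // eq_sym.
  by apply: cat_neq; rewrite // eq_sym.
have Eout T : E T -> ~~ E (u T) && ~~ E (h T).
  move=> /EP[s /Huh[eu eh]]; rewrite /E /= eu eh !take_q //.
  by rewrite !(eq_sym _ q1) n13 n12.
have [cyc fixd] := commutator_rot3 Edef Eout.
exists (u^-1 * h^-1 * u * h)%g; first by rewrite !groupM ?groupV.
move=> T; rewrite /on_prefix.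
have tdT : word T = take j (word T) ++ drop j (word T) by rewrite cat_take_drop.
have [e1|e1] := eqVneq (take j (word T)) q1.
  have ET : E T by apply/eqP.
  have [-> _ _] := cyc _ ET; rewrite e1 rot3_1; rewrite e1 in tdT.
  by have [_ ->] := Huh _ _ tdT.
have [e2|e2] := eqVneq (take j (word T)) q2.
  rewrite e2 rot3_2 //; rewrite e2 in tdT.
  have [S eS] := H2 _ (ex_intro _ T tdT); have [eu eh] := Huh _ _ eS.
  have -> : T = h S by apply: word_inj; rewrite eh.
  by have [_ -> _] := cyc _ (PE _ _ eS); rewrite eu eh drop_q.
have [e3|e3] := eqVneq (take j (word T)) q3.
  rewrite e3 rot3_3 //; rewrite e3 in tdT.
  have [S eS] := H3 _ (ex_intro _ T tdT); have [eu eh] := Huh _ _ eS.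
  have -> : T = u S by apply: word_inj; rewrite eu.
  by have [_ _ ->] := cyc _ (PE _ _ eS); rewrite eS eu drop_q.
rewrite rot3_id // -tdT fixd // => S /EP[s /Huh[eu eh]].
split; apply/eqP => /(congr1 word) e; move: e2 e3.
  by rewrite e eu take_q // eqxx.
by rewrite e eh take_q // eqxx.
Qed.

End Prefixes.

(** * Linear extensions *)

Section LinearExtensions.
Context (B : finType) (lt : rel B).
Hypothesis lt_irr : irreflexive lt.
Hypothesis lt_trans : transitive lt.
Implicit Types (x y v l : B) (s p : seq B) (K : {set B}).

Definition lin s := forall s1 x s2, s = s1 ++ x :: s2 ->
  x \notin s1 /\ forall y, lt y x -> y \in s1.

Definition lin_ext K s := lin s /\ s =i K.
Definition ideal K := forall x y, x \in K -> lt y x -> y \in K.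
Definition addable K v := v \notin K /\ forall y, lt y v -> y \in K.
Definition corner K l := l \in K /\ forall y, y \in K -> ~~ lt l y.
Definition incomp x y := [/\ x != y, ~~ lt x y & ~~ lt y x].

Lemma mem_cat_split x s : x \in s -> exists s1 s2, s = s1 ++ x :: s2.
Proof. by case/splitPr=> s1 s2; exists s1, s2. Qed.

Lemma lin_nil : lin [::].
Proof. by move=> [|? ?]. Qed.

Lemma lin_catl s1 s2 : lin (s1 ++ s2) -> lin s1.
Proof. by move=> H t1 x t2 e; apply: (H t1 x (t2 ++ s2)); rewrite e -catA. Qed.

Lemma lin_rcons s x : lin (rcons s x) <-> lin s /\ x \notin s /\ forall y, lt y x -> y \in s.
Proof.
split=> [H|[Hs [nx Hx]] t1 z t2].
  split; first by apply: (@lin_catl _ [:: x]); rewrite cats1.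
  by apply: (H _ _ [::]); rewrite cats1.
case/lastP: t2 => [|t2 y].
  by rewrite cats1 => /rcons_inj[<- <-].
by rewrite -rcons_cons -rcons_cat => /rcons_inj[e _]; apply: Hs e.
Qed.

Lemma lin_uniq s : lin s -> uniq s.
Proof.
elim/last_ind: s => // s x IH /lin_rcons[/IH us [nx _]].
by rewrite rcons_uniq nx.
Qed.

Lemma lin_ext_size K s : lin_ext K s -> size s = #|K|.
Proof. by case=> /lin_uniq us e; rewrite -(card_uniqP us); apply: eq_card. Qed.

Lemma lin_ext_rcons K s v : lin_ext K s -> addable K v -> lin_ext (v |: K) (rcons s v).
Proof.
case=> ls es [nv Hv]; split.
  by apply/lin_rcons; split=> //; rewrite es nv; split=> // y /Hv; rewrite es.
by move=> y; rewrite mem_rcons inE es !inE.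
Qed.

Lemma lin_ext_last K s x : lin_ext K (rcons s x) ->
  [/\ corner K x, addable (K :\ x) x & lin_ext (K :\ x) s].
Proof.
case=> /lin_rcons[ls [nx Hx]] es.
have eK y : (y \in K :\ x) = (y \in s).
  by rewrite !inE -es mem_rcons inE; case: eqVneq => // ->; rewrite (negbTE nx).
have pre y z : y \in s -> lt z y -> z \in s.
  move=> /mem_cat_split[s1 [s2 e]] zy; rewrite e mem_cat.
  by have [_ /(_ z zy)->] := ls _ _ _ e.
split; last by split=> // y; rewrite eK.
- split=> [|y]; first by rewrite -es mem_rcons mem_head.
  rewrite -es mem_rcons inE => /predU1P[->|ys]; first by rewrite lt_irr.
  by apply: contra nx; apply: pre.
- by split=> [|y /Hx]; rewrite ?eK.
Qed.

Lemma addableU1 K v : v \notin K -> (v |: K) :\ v = K.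
Proof. exact: setU1K. Qed.

Lemma ideal_addable K v : ideal K -> addable K v -> ideal (v |: K).
Proof.
move=> iK [nv Hv] x y; rewrite !inE => /predU1P[->|xK] yx.
  by rewrite Hv ?orbT.
by rewrite (iK _ _ xK yx) orbT.
Qed.

Lemma corner_addable K l : ideal K -> corner K l -> addable (K :\ l) l /\ ideal (K :\ l).
Proof.
move=> iK [lK Hl]; split.
  split=> [|y yl]; first by rewrite !inE eqxx.
  rewrite !inE (iK _ _ lK yl) andbT; apply: contraTneq yl => ->.
  by rewrite lt_irr.
move=> x y; rewrite !inE => /andP[_ xK] yx; rewrite (iK _ _ xK yx) andbT.
by apply: contraTneq yx => ->; apply: Hl.
Qed.

Lemma corner_above K x : x \in K -> exists2 y, corner K y & (y = x) \/ lt x y.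
Proof.
have [n] := ubnP #|[set z in K | lt x z]|; elim: n x => // n IH x ltn xK.
case: (pickP [pred z in K | lt x z]) => [z /= /andP[zK xz]|no].
  have [] := IH z _ zK.
    rewrite -ltnS; apply: leq_trans ltn; rewrite ltnS; apply: proper_card.
    apply/properP; split; last by exists z; rewrite !inE zK ?xz ?lt_irr.
    by apply/subsetP => y; rewrite !inE => /andP[-> /(lt_trans xz)].
  move=> y cy yz; exists y => //; right.
  by case: yz => [->//|]; apply: lt_trans.
exists x; last by left.
by split=> // y yK; apply/negP => xy; have := no y; rewrite /= yK xy.
Qed.

Lemma lin_ext_exists K : ideal K -> exists s, lin_ext K s.
Proof.
have [n] := ubnP #|K|; elim: n K => // n IH K ltn iK.
have [->|[x xK]] := set_0Vmem K.
  by exists [::]; split=> [|y]; [exact: lin_nil|rewrite inE].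
have [y cy _] := corner_above xK; have [ay iy] := corner_addable iK cy.
have [] := IH _ _ iy.
  by move: ltn; rewrite (cardsD1 y) cy.1.
move=> s Hs; exists (rcons s y); rewrite -(setD1K cy.1).
exact: lin_ext_rcons.
Qed.

Lemma lin_ext_swap K s1 x y s2 : ~~ lt x y ->
  lin_ext K (s1 ++ x :: y :: s2) -> lin_ext K (s1 ++ y :: x :: s2).
Proof.
move=> nxy [ls es]; split; last first.
  by move=> z; rewrite -es !mem_cat !inE; do !bool_congr.
elim/last_ind: s2 {es} ls => [|s2 z IH].
  rewrite -[s1 ++ [:: x; y]]/(s1 ++ ([:: x] ++ [:: y])) catA !cats1.
  rewrite -[s1 ++ [:: y; x]]/(s1 ++ ([:: y] ++ [:: x])) catA !cats1.
  case/lin_rcons=> /lin_rcons[ls [nx Hx]] [ny Hy].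
  move: ny; rewrite mem_rcons inE negb_or => /andP[yx ny].
  apply/lin_rcons; split.
    apply/lin_rcons; split=> //; split=> // z zy.
    have := Hy z zy; rewrite mem_rcons inE => /predU1P[e|//].
    by rewrite e (negbTE nxy) in zy.
  split; first by rewrite mem_rcons inE negb_or eq_sym yx.
  by move=> z /Hx zs; rewrite mem_rcons inE zs orbT.
rewrite -!rcons_cons -!rcons_cat => /lin_rcons[/IH ls [nz Hz]].
have em w : (w \in s1 ++ [:: y, x & s2]) = (w \in s1 ++ [:: x, y & s2]).
  by rewrite !mem_cat !inE; do !bool_congr.
by apply/lin_rcons; split=> //; rewrite em; split=> // w /Hz; rewrite em.
Qed.

(** An element strictly between would have to occur after [x] and before [y]. Hence consecutive
    comparable letters form a cover. *)
Lemma lin_consecutive s1 x y s2 z : lin (s1 ++ x :: y :: s2) -> lt x z -> ~~ lt z y.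
Proof.
move=> ls xz; apply/negP => zy.
have [] := ls (rcons s1 x) y s2 _; first by rewrite cat_rcons.
move=> _ /(_ z zy); rewrite mem_rcons inE => /predU1P[e|zs].
  by rewrite e lt_irr in xz.
have [nx _] := ls s1 x (y :: s2) erefl.
have [t1 [t2 e]] := mem_cat_split zs; rewrite e in nx ls.
have [] := ls t1 z (t2 ++ x :: y :: s2) _; first by rewrite -catA.
by move=> _ /(_ x xz) xt; rewrite mem_cat xt in nx.
Qed.

(** Linear extensions are connected under exchanges of incomparable neighbours: the last letter of
    [s'] is maximal in [K], so it can be moved step by step to the end of [s], and induction treats
    [K] without that letter. *)
Lemma lin_ext_connected K (P : seq B -> Prop) s s' :
    (forall s1 x y s2, incomp x y -> lin_ext K (s1 ++ x :: y :: s2) ->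
      P (s1 ++ x :: y :: s2) -> P (s1 ++ y :: x :: s2)) ->
  lin_ext K s -> lin_ext K s' -> P s -> P s'.
Proof.
elim/last_ind: s' K P s => [|s' x IH] K P s HP Ls Ls' Ps.
  by have /eqP := lin_ext_size Ls; rewrite -(lin_ext_size Ls') /= => /nilP <-.
have [cx ax Ls0'] := lin_ext_last Ls'.
have : x \in s by rewrite Ls.2 cx.1.
case/mem_cat_split=> a [b e]; rewrite {s}e in Ls Ps.
suff [Lx Px] : lin_ext K (rcons (a ++ b) x) /\ P (rcons (a ++ b) x).
  have [_ _ Lab] := lin_ext_last Lx.
  apply: (IH _ (fun t => P (rcons t x)) _ _ Lab Ls0' Px) => s1 y z s2 yz Lt.
  rewrite !rcons_cat /= => Pt; apply: HP => //.
  by have := lin_ext_rcons Lt ax; rewrite (setD1K cx.1) rcons_cat.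
elim: b a Ls Ps => [|y b IHb] a Ls Ps; first by rewrite cats0 -cats1.
have yK : y \in K by rewrite -Ls.2 mem_cat !inE eqxx !orbT.
have nxy := cx.2 _ yK.
have := lin_uniq Ls.1; rewrite cat_uniq => /and3P[_ /norP[xa /norP[ya _]]].
rewrite /= inE negb_or => /andP[/andP[xy _] _].
have nyx : ~~ lt y x.
  apply/negP => yx; have [_ /(_ _ yx)] := Ls.1 _ _ _ erefl.
  by rewrite (negbTE ya).
rewrite -cat_rcons; apply: IHb; rewrite cat_rcons.
  exact: lin_ext_swap Ls.
exact: HP.
Qed.

End LinearExtensions.

(** * Growing an ideal *)

Section Growth.
Context (B : finType) (lt : rel B) (c : B -> int).
Context (X : finType) (G : {group {perm X}}) (word : X -> seq B).
Hypothesis lt_irr : irreflexive lt.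
Hypothesis lt_trans : transitive lt.
Hypothesis incomp_dist : forall x y, incomp lt x y -> 1 < cdist c x y.
Hypothesis cover_dist : forall x y,
  lt x y -> (forall z, lt x z -> ~~ lt z y) -> cdist c x y = 1.
Hypothesis word_inj : injective word.
Hypothesis word_lin : forall T, lin_ext lt [set: B] (word T).
Hypothesis swapsG : forall t a, 1 < a ->
  exists2 u, u \in G & forall T, word (u T) = swap_at c t a (word T).
Implicit Types (x y v l : B) (s p q : seq B) (K : {set B}).

Local Notation ext := (lin_ext lt).
Local Notation three_cycle := (three_cycle G word).
Local Notation acts_on_prefix := (acts_on_prefix G word).
Local Notation linked := (linked G word).
Local Notation dist := (cdist c).
Local Notation swap := (swap_at c).

(** The three linear extensions keep the last clause from being vacuous; they supply a third word
    when two are to be linked. *)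
Definition alternating K :=
  [/\ ideal lt K,
      exists p1 p2 p3, uniq [:: p1; p2; p3] /\ [/\ ext K p1, ext K p2 & ext K p3]
    & forall p1 p2 p3, uniq [:: p1; p2; p3] ->
        ext K p1 -> ext K p2 -> ext K p3 -> three_cycle #|K| p1 p2 p3].

Lemma acts_on_prefix_swap j t a : t.+1 < j -> 1 < a -> acts_on_prefix j (swap t a).
Proof.
move=> tj a1; have [u uG Hu] := swapsG t a1; exists u => // T.
by rewrite on_prefix_swap_at.
Qed.

Lemma linked_swap j t a p q : t.+1 < j -> 1 < a ->
  linked j p q -> linked j (swap t a p) (swap t a q).
Proof.
move=> tj a1; apply: linked_act (@swap_atK _ c t a) (@swap_atK _ c t a) => //.
  exact: acts_on_prefix_swap.
exact: size_swap_at.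
Qed.

Lemma lin_consecutive_dist s1 x y s2 : lin lt (s1 ++ x :: y :: s2) ->
  1 < dist x y -> ~~ lt x y.
Proof.
move=> ls d; apply/negP => xy; move: d; rewrite (cover_dist xy) // => z xz.
exact: lin_consecutive ls xz.
Qed.

Lemma swap_lin_ext K t a s : 1 < a -> ext K s -> ext K (swap t a s).
Proof.
move=> a1 Ls; case: (swap_atP c t a s) => // s1 x y s2 _ e d.
rewrite e in Ls; apply: lin_ext_swap (Ls).
by apply: lin_consecutive_dist Ls.1 _; rewrite d.
Qed.

Lemma swap_rcons t a p v : t.+1 < size p -> swap t a (rcons p v) = rcons (swap t a p) v.
Proof.
move=> tp; rewrite -!cats1 -(on_prefix_swap_at _ _ tp) /on_prefix take_size_cat //.
by rewrite drop_size_cat.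
Qed.

Lemma swap_last2 p x y a :
  swap (size p) a (rcons (rcons p x) y) =
  if dist x y == a then rcons (rcons p y) x else rcons (rcons p x) y.
Proof. by rewrite -!cats1 -!catA /= swap_at_cat. Qed.

(** A linear extension that does not end in [v] ends in a corner [l]. Exchanging the last two
    letters turns a word ending in [l v] into one ending in [v l] and fixes a word ending in [l' v],
    as the distances differ; so it carries a link among words ending in [v] to a link with a word
    ending in [l]. *)
Lemma linked_addable K v : ideal lt K -> addable lt K v ->
    (forall p p', ext K p -> ext K p' -> linked #|K|.+1 (rcons p v) (rcons p' v)) ->
    (forall l, corner lt (v |: K) l -> l != v ->
      exists l', [/\ corner lt K l', l' != l & dist l' v != dist l v]) ->
  forall q q', ext (v |: K) q -> ext (v |: K) q' -> linked #|K|.+1 q q'.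
Proof.
move=> iK aK HX HC.
suff H q : ext (v |: K) q -> exists2 p, ext K p & linked #|K|.+1 (rcons p v) q.
  move=> q q' /H[p Lp pq] /H[p' Lp' pq'].
  apply: linked_trans (linked_sym pq) _; apply: linked_trans pq'.
  exact: HX.
case/lastP: q => [|q l] Lq.
  by have := Lq.2 v; rewrite !inE eqxx.
have [cl al Lq0] := lin_ext_last lt_irr Lq.
have [elv|nlv] := eqVneq l v.
  rewrite elv addableU1 ?aK.1 // in Lq0; exists q => //; rewrite elv; by left.
have lK : l \in K by have := cl.1; rewrite !inE (negbTE nlv).
have clK : corner lt K l by split=> // y yK; apply: cl.2; rewrite !inE yK orbT.
have a1 : 1 < dist l v.
  apply: incomp_dist; split=> //; first by apply: cl.2; rewrite !inE eqxx.
  by apply/negP => /(iK _ _ lK); rewrite (negbTE aK.1).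
have [l' [cl' nll' dl']] := HC l cl nlv.
have [_ il] := corner_addable lt_irr iK clK.
have [_ il'] := corner_addable lt_irr iK cl'.
have [p0 Lp0] := lin_ext_exists lt_irr lt_trans il.
have [p1 Lp1] := lin_ext_exists lt_irr lt_trans il'.
have LK l0 p : corner lt K l0 -> ext (K :\ l0) p -> ext K (rcons p l0).
  move=> cl0 Lp; rewrite -(setD1K cl0.1); apply: lin_ext_rcons Lp _.
  exact: (corner_addable lt_irr iK cl0).1.
have sz l0 p : corner lt K l0 -> ext (K :\ l0) p -> (size p).+1 = #|K|.
  by move=> cl0 /lin_ext_size->; rewrite (cardsD1 l0 K) cl0.1.
have L0 := LK _ _ clK Lp0; have L1 := LK _ _ cl' Lp1.
have s0 := sz _ _ clK Lp0; have s1 := sz _ _ cl' Lp1.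
exists (rcons p1 l') => //.
have base : linked #|K|.+1 (rcons (rcons p1 l') v) (rcons (rcons p0 v) l).
  have := @linked_swap #|K|.+1 (size p0) (dist l v) _ _ _ a1 (HX _ _ L1 L0).
  rewrite swap_last2 eqxx (_ : size p0 = size p1); last by lia.
  by rewrite swap_last2 (negbTE dl'); apply; lia.
have Lv0 : ext ((v |: K) :\ l) (rcons p0 v).
  have : ext (v |: K) (rcons (rcons p0 v) l).
    have := lin_ext_rcons L0 aK; rewrite -!cats1 -!catA /= => Lpv.
    by apply: lin_ext_swap (Lpv); apply: lin_consecutive_dist Lpv.1 a1.
  by case/(lin_ext_last lt_irr).
(* The words ending in [l] are connected by exchanges before [l]. Such an exchange may also alter
   the reference word, which still ends in [v] and is linked back by [HX]. *)
apply: (lin_ext_connected lt_irr _ Lv0 Lq0 (P := fun s => linked _ _ (rcons s l))) => //.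
move=> t1 x y t2 xy Lt H.
have tK : (size t1).+1 < #|K|.
  have := cardsD1 l (v |: K); rewrite cl.1 cardsU1 aK.1 -(lin_ext_size Lt) size_cat /=.
  lia.
have d1 := incomp_dist xy.
rewrite !rcons_cat /= in H *.
have H' : linked #|K|.+1 _ _ := @linked_swap _ (size t1) (dist x y) _ _ (leqW tK) d1 H.
rewrite swap_at_cat eqxx swap_rcons ?(lin_ext_size L1) // in H'.
apply: linked_trans H'.
by apply: HX => //; apply: swap_lin_ext.
Qed.

Lemma cardU1 K v : v \notin K -> #|v |: K| = #|K|.+1.
Proof. by move=> nv; rewrite cardsU1 nv. Qed.

Lemma rcons_uniq3 p1 p2 p3 v :
  uniq [:: rcons p1 v; rcons p2 v; rcons p3 v] = uniq [:: p1; p2; p3].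
Proof. exact: (map_inj_uniq (@rcons_injl _ v) [:: p1; p2; p3]). Qed.

Lemma alternating_addable K v : alternating K -> addable lt K v ->
    (forall p p', ext K p -> ext K p' -> linked #|K|.+1 (rcons p v) (rcons p' v)) ->
    (forall l, corner lt (v |: K) l -> l != v ->
      exists l', [/\ corner lt K l', l' != l & dist l' v != dist l v]) ->
  alternating (v |: K).
Proof.
move=> [iK [p1 [p2 [p3 [un [L1 L2 L3]]]]] _] aK HX HC; split.
- exact: ideal_addable.
- exists (rcons p1 v), (rcons p2 v), (rcons p3 v); rewrite rcons_uniq3; split=> //.
  by split; apply: lin_ext_rcons.
- move=> q1 q2 q3 unq Lq1 Lq2 Lq3; rewrite cardU1 ?aK.1 //.
  by apply: linked_C3 => //; apply: linked_addable HC _ _ _ _.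
Qed.

Lemma word_next K T p s v : v \notin K -> ext K p -> word T = p ++ s ->
  exists w s', s = w :: s' /\ addable lt K w.
Proof.
move=> nv [_ Kp] e; have [lT allT] := word_lin T.
case: s e => [|w s'] e.
  by have := allT v; rewrite e cats0 Kp (negbTE nv) inE.
exists w, s'; split=> //; have [nw Hw] := lT _ _ _ e.
by split=> [|y /Hw]; rewrite -Kp.
Qed.

(** A linear extension of [K] is always followed by [v], so a 3-cycle on these prefixes is also a
    3-cycle on the prefixes lengthened by [v]. *)
Lemma alternating_forced K v : alternating K -> addable lt K v ->
    (forall w, addable lt K w -> w = v) ->
    (forall l, corner lt (v |: K) l -> l != v ->
      exists l', [/\ corner lt K l', l' != l & dist l' v != dist l v]) ->
  alternating (v |: K).
Proof.
move=> gK aK only HC; apply: alternating_addable => //.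
case: (gK) => iK [p1 [p2 [p3 [un [L1 L2 L3]]]]] HK p p' Lp Lp'.
have [->|npp] := eqVneq p p'; first by left.
have [r [Lr nrp nrp']] : exists r, [/\ ext K r, p != r & p' != r].
  move: un; rewrite /= !inE !negb_or andbT => /andP[/andP[n12 n13] n23].
  have [e1|m1] := boolP (p1 \in [:: p; p']); last first.
    by exists p1; rewrite !inE negb_or in m1; case/andP: m1; rewrite !(eq_sym p1).
  have [e2|m2] := boolP (p2 \in [:: p; p']); last first.
    by exists p2; rewrite !inE negb_or in m2; case/andP: m2; rewrite !(eq_sym p2).
  exists p3; move: e1 e2 n12 n13 n23; rewrite !inE.
  by move=> /orP[]/eqP-> /orP[]/eqP->; rewrite ?eqxx.
have unr : uniq [:: p; p'; r] by rewrite /= !inE !negb_or npp nrp nrp'.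
right; exists (rcons r v); have [sz _ [u uG Hu]] := HK _ _ _ unr Lp Lp' Lr; split.
- by move: sz; rewrite /= !size_rcons.
- by rewrite rcons_uniq3.
exists u => // T; rewrite Hu /on_prefix.
set j := #|K|; set w := word T.
have step q : ext K q -> take j w = q -> w = rcons q v ++ drop j.+1 w.
  move=> Lq e; have ew : w = q ++ drop j w by rewrite -e cat_take_drop.
  have [x [s [es ax]]] := word_next aK.1 Lq ew.
  rewrite -(only _ ax) {1}ew es cat_rcons; congr (_ ++ _ :: _).
  by rewrite -[j.+1]add1n -drop_drop es /= drop0.
have take_step q : ext K q -> (take j.+1 w == rcons q v) = (take j w == q).
  move=> Lq; have sq := lin_ext_size Lq; apply/eqP/eqP => [e|e].
    have -> : take j w = take j (take j.+1 w) by rewrite take_takel.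
    by rewrite e -cats1 take_size_cat.
  by rewrite (step _ Lq e) take_size_cat // size_rcons sq.
rewrite /rot3 !take_step //.
case: eqP => [/(step _ Lp) e|_]; last case: eqP => [/(step _ Lp') e|_];
  last case: eqP => [/(step _ Lr) e|_]; last by rewrite !cat_take_drop.
all: rewrite cat_rcons; congr (_ ++ _); rewrite [in LHS]e cat_rcons drop_size_cat //;
  by rewrite /j (lin_ext_size Lp, lin_ext_size Lp', lin_ext_size Lr).
Qed.

(* The commutator isolates the words beginning with a linear extension of [K] that ends in
   [l], followed by [v]. *)
Lemma alternating_step K v l l2 : alternating K -> addable lt K v ->
    corner lt K l -> corner lt K l2 -> 1 < dist l v ->
    (forall w, addable lt K w -> w != v -> dist l w != dist l v) ->
    (forall w, addable lt K w -> dist l2 w != dist l v) ->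
    (exists p p', [/\ ext (K :\ l2) p, ext (K :\ l2) p' & p != p']) ->
  alternating (v |: K).
Proof.
move=> gK aK cl cl2 d1 Hl Hl2 [p2 [p3 [Lp2 Lp3 np23]]].
have [iK _ HK] := gK.
have dl2 : dist l2 v != dist l v by apply: Hl2.
have nll2 : l2 != l by apply: contraNneq dl2 => ->.
have [_ il] := corner_addable lt_irr iK cl.
have [p1 Lp1] := lin_ext_exists lt_irr lt_trans il.
have LK l0 p : corner lt K l0 -> ext (K :\ l0) p -> ext K (rcons p l0).
  move=> cl0 Lp; rewrite -(setD1K cl0.1); apply: lin_ext_rcons Lp _.
  exact: (corner_addable lt_irr iK cl0).1.
have sz l0 p : corner lt K l0 -> ext (K :\ l0) p -> (size p).+1 = #|K|.
  by move=> cl0 /lin_ext_size->; rewrite (cardsD1 l0 K) cl0.1.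
have L1 := LK _ _ cl Lp1.
have nlv : l != v by apply: contraTneq cl.1 => ->; exact: aK.1.
(* [u] rotates three prefixes, one ending in [l] and two in [l2]; [h] exchanges the last letter of
   such a prefix with the next one if their distance is [dist l v]. The distance conditions leave
   only the words beginning with [p1 l v] to be moved by both. *)
have key p p' : ext (K :\ l2) p -> ext (K :\ l2) p' -> p != p' ->
    linked #|K|.+1 (rcons (rcons p1 l) v) (rcons (rcons p l2) v).
  move=> Lp Lp' npp'; have L2 := LK _ _ cl2 Lp; have L3 := LK _ _ cl2 Lp'.
  have n12 p0 : rcons p1 l != rcons p0 l2 by rewrite eqseq_rcons (eq_sym l) (negbTE nll2) andbF.
  have un : uniq [:: rcons p1 l; rcons p l2; rcons p' l2].
    by rewrite /= !inE !negb_or !n12 eqseq_rcons eqxx (negbTE npp').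
  have [_ _ [u uG Hu]] := HK _ _ _ un L1 L2 L3.
  have [h hG Hh] := swapsG (size p1) d1.
  have s1 := sz _ _ cl Lp1; have s2 := sz _ _ cl2 Lp; have s3 := sz _ _ cl2 Lp'.
  right; exists (rcons (rcons p1 v) l); apply/three_cycle_inv.
  have rotw q s T : ext K q -> word T = q ++ s ->
      word (u T) = rot3 (rcons p1 l) (rcons p l2) (rcons p' l2) q ++ s.
    by move=> /lin_ext_size sq e; rewrite Hu e /on_prefix take_size_cat // drop_size_cat.
  have swapw p0 x y s : size p0 = size p1 ->
      swap (size p1) (dist l v) (rcons (rcons p0 x) y ++ s) =
      if dist x y == dist l v then rcons (rcons p0 y) x ++ s else rcons (rcons p0 x) y ++ s.
    by move=> <-; rewrite !cat_rcons swap_at_cat.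
  apply: (three_cycle_commutator word_inj (u := u) (h := h)) => //.
  - by rewrite /= !size_rcons s1 s2 !eqxx.
  - rewrite /= !inE !negb_or !andbT; rewrite !(inj_eq (@rcons_injl _ _)) n12 andbT.
    by rewrite !eqseq_rcons (negbTE nlv) eq_sym (negbTE nlv) !andbF.
  - move=> T s e; split.
      by rewrite cat_rcons in e; rewrite (rotw _ _ _ L1 e) rot3_1 -cat_rcons.
    by rewrite Hh e swapw ?eqxx.
  - move=> s [T e]; exists (h T); rewrite Hh e swapw // cdistC eqxx //.
  - move=> s [T e]; exists (u (u T)).
    rewrite cat_rcons in e; have e' := rotw _ _ _ L2 e; rewrite rot3_2 ?n12 // in e'.
    by have := rotw _ _ _ L3 e'; rewrite rot3_3 ?n12 ?cat_rcons // eqseq_rcons eqxx andbT.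
  - move=> T uT hT.
    have ew : word T = take #|K| (word T) ++ drop #|K| (word T) by rewrite cat_take_drop.
    have : take #|K| (word T) \in [:: rcons p1 l; rcons p l2; rcons p' l2].
      apply: contraNT uT; rewrite !inE !negb_or => /and3P[m1 m2 m3].
      by apply/eqP/word_inj; rewrite Hu /on_prefix rot3_id // cat_take_drop.
    have hw q l0 p0 : q = rcons p0 l0 -> ext K q -> take #|K| (word T) = q ->
        exists w s, [/\ word T = rcons q w ++ s, addable lt K w & dist l0 w = dist l v].
      move=> eq Lq e; rewrite e in ew.
      have [w [s [es aw]]] := word_next aK.1 Lq ew.
      exists w, s; rewrite cat_rcons -es; split=> //.
      apply/eqP; apply: contraNT hT => dlw; apply/eqP/word_inj.
      rewrite Hh ew es eq -cat_rcons swapw ?(negbTE dlw) //.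
      by have := lin_ext_size Lq; rewrite eq size_rcons; lia.
    rewrite !inE => /or3P[]/eqP e.
    + have [w [s [-> aw dw]]] := hw _ _ _ erefl L1 e.
      have [->|nwv] := eqVneq w v; first by exists s.
      by have := Hl w aw nwv; rewrite dw eqxx.
    + have [w [s [_ aw dw]]] := hw _ _ _ erefl L2 e.
      by have := Hl2 w aw; rewrite dw eqxx.
    + have [w [s [_ aw dw]]] := hw _ _ _ erefl L3 e.
      by have := Hl2 w aw; rewrite dw eqxx.
have key2 := key _ _ Lp2 Lp3 np23.
have key3 : linked #|K|.+1 (rcons (rcons p1 l) v) (rcons (rcons p3 l2) v).
  by apply: (key _ p2) => //; rewrite eq_sym.
(* The 3-cycle through [p2 l2], [p] and [p3 l2] fixes [p1 l], so it carries the link [key2] to a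
   link between [p1 l v] and [p v]. *)
have all1 p : ext K p -> linked #|K|.+1 (rcons (rcons p1 l) v) (rcons p v).
  move=> Lp; have [->|n1] := eqVneq p (rcons p1 l); first by left.
  have [->//|n2] := eqVneq p (rcons p2 l2).
  have [->//|n3] := eqVneq p (rcons p3 l2).
  have un : uniq [:: rcons p2 l2; p; rcons p3 l2].
    by rewrite /= !inE !negb_or eqseq_rcons eqxx andbT np23 n3 eq_sym n2.
  have H3 := HK _ _ _ un (LK _ _ cl2 Lp2) Lp (LK _ _ cl2 Lp3).
  have [_ _ a3] := H3.
  have sp := three_cycle_size_preserving H3.
  have sp' := three_cycle_size_preserving (three_cycle_inv H3).
  set f := rot3 _ _ _ in a3 sp; set g := rot3 _ _ _ in sp'.
  have opf q x : size q = #|K| -> on_prefix #|K| f (rcons q x) = rcons (f q) x.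
    by move=> sq; rewrite /on_prefix -!cats1 take_size_cat // drop_size_cat.
  have := linked_act (acts_on_prefixS a3) _ _ _ key2.
  have opK f1 g1 : size_preserving f1 -> cancel f1 g1 ->
      cancel (on_prefix #|K| f1) (on_prefix #|K| g1).
    by move=> s1 fg w; rewrite on_prefix_comp // /on_prefix /= fg cat_take_drop.
  move=> /(_ (on_prefix #|K| g)); rewrite !opf ?(lin_ext_size L1) ?(lin_ext_size (LK _ _ cl2 Lp2)) //.
  rewrite /f rot3_1 rot3_id 1?eq_sym //; last first.
  - by rewrite eqseq_rcons (negbTE nll2) andbF.
  - by rewrite eqseq_rcons (negbTE nll2) andbF.
  apply.
  - exact: size_on_prefix.
  - by apply: opK => //; apply: rot3K.
  - by apply: opK => //; apply: rot3K; case: (three_cycle_inv H3).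
apply: alternating_addable => // [p p' Lp Lp'|x cx nxv].
  by apply: linked_trans (all1 _ Lp'); apply/linked_sym/all1.
have [->|nxl] := eqVneq x l; first by exists l2.
have [e|ne] := eqVneq (dist x v) (dist l v).
  exists l2; rewrite e; split=> //; apply: contraNneq dl2 => ->; exact/eqP.
by exists l; rewrite eq_sym nxl eq_sym ne.
Qed.

(** In the application [rcons s0 p] is the top row, and [y], [v] are the first boxes below it in the
    two leftmost columns. By the last hypothesis only words beginning with [s0 y p v] are moved both
    by the exchange at distance [dist y p] and by the next one at distance [dist p v]; their
    commutator is the first 3-cycle. *)
Lemma alternating_base s0 (p y v : B) (K1 := y |: [set x in rcons s0 p]) :
    ideal lt K1 -> addable lt K1 v ->
    ext (v |: K1) (s0 ++ [:: y; p; v]) ->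
    incomp lt y p -> incomp lt p v -> dist y v != dist p v ->
    (forall x, corner lt K1 x -> x = p \/ x = y) ->
    (forall t1 x z t2, rcons s0 p = t1 ++ x :: z :: t2 -> dist x z = 1) ->
    (forall x z, x \in rcons s0 p -> z \in rcons s0 p -> ~ incomp lt x z) ->
    (forall T s1 x1 x2 x3 s2, word T = s1 ++ x1 :: x2 :: x3 :: s2 -> size s1 = size s0 ->
      dist x1 x2 = dist y p -> dist x2 x3 = dist p v ->
      s1 ++ [:: x1; x2; x3] = s0 ++ [:: y; p; v]) ->
  alternating (v |: K1).
Proof.
move=> iK1 aK1 Lq1 yp pv dyv cornK1 row_dist row_chain pinned.
have dyp := incomp_dist yp; have dpv := incomp_dist pv.
set m := size s0.
pose q1 := s0 ++ [:: y; p; v]; pose q2 := s0 ++ [:: y; v; p]; pose q3 := s0 ++ [:: p; y; v].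
have sw1 s : swap m (dist y p) (q1 ++ s) = q3 ++ s.
  by rewrite /q1 /q3 -!catA /= swap_at_cat eqxx.
have sw2 s : swap m.+1 (dist p v) (q1 ++ s) = q2 ++ s.
  have := swap_at_cat c (rcons s0 y) p v s (dist p v).
  by rewrite eqxx size_rcons !cat_rcons /q1 /q2 -!catA.
have Lq3 : ext (v |: K1) q3.
  by have := swap_lin_ext m dyp Lq1; have := sw1 [::]; rewrite !cats0 => ->.
have Lq2 : ext (v |: K1) q2.
  by have := swap_lin_ext m.+1 dpv Lq1; have := sw2 [::]; rewrite !cats0 => ->.
have cK : #|v |: K1| = #|K1|.+1 by rewrite cardU1 ?aK1.1.
have sK : #|K1| = m.+2.
  by have := lin_ext_size Lq1; rewrite size_cat cK /= addn3 => -[].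
have un : uniq [:: q1; q2; q3].
  have [nyp _ _] := yp; have [npv _ _] := pv.
  rewrite /= !inE !negb_or /q1 /q2 /q3 !eqseq_cat // eqxx /= !eqseq_cons.
  by rewrite (negbTE nyp) (negbTE npv) !andbF.
have HC3 : three_cycle #|K1|.+1 q1 q2 q3.
  have [u uG Hu] := swapsG m dyp; have [h hG Hh] := swapsG m.+1 dpv.
  apply: (three_cycle_commutator word_inj (u := u) (h := h)) => //.
  - by rewrite /= !size_cat /= sK addn3 !eqxx.
  - by move=> T s e; rewrite Hu Hh e sw1 sw2.
  - by move=> s [T e]; exists (h T); rewrite Hh e -sw2 swap_atK.
  - by move=> s [T e]; exists (u T); rewrite Hu e -sw1 swap_atK.
  move=> T uT hT.
  have : word (u T) != word T by rewrite (inj_eq word_inj).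
  have : word (h T) != word T by rewrite (inj_eq word_inj).
  rewrite Hu Hh; case: (swap_atP c m.+1) => [t1 y1 z1 t2 st e d _|? ? ? ? _ _ _|_]; rewrite ?eqxx //.
  case: (swap_atP c m) => [s1 x2 y2 s2 ss e' d' _|? ? ? ? _ _ _|_]; rewrite ?eqxx //.
  have : rcons s1 x2 ++ y2 :: s2 = t1 ++ [:: y1, z1 & t2] by rewrite cat_rcons -e -e'.
  move/eqP; rewrite eqseq_cat ?size_rcons ?ss // => /andP[_ /eqP[ey es]].
  exists t2; rewrite /q1 -(pinned T s1 x2 y2 z1 t2) ?e' ?es -?catA // ey.
  exact: d.
pose q0 := rcons s0 p ++ [:: y].
have l0 : linked #|K1|.+1 (rcons q0 v) (rcons (rcons s0 y ++ [:: p]) v).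
  right; exists q2; rewrite /q0 -!cats1 -!catA /=.
  by apply/three_cycle_swap/three_cycle_inv.
have Lq0 : ext K1 q0.
  have := Lq3; rewrite /q3 (_ : _ ++ _ = rcons q0 v).
    by case/(lin_ext_last lt_irr); rewrite addableU1 ?aK1.1.
  by rewrite /q0 -!cats1 -!catA.
(* Neighbours in the row have distance 1, so exchanges inside the row leave the reference word
   fixed, while they move [y] through the row in the other words. *)
have fix0 t a : t < m -> 1 < a -> swap t a (rcons q0 v) = rcons q0 v.
  move=> tm a1; have tm1 : t.+1 < m.+1 by [].
  rewrite /q0 swap_rcons ?size_cat ?size_rcons ?addn1 1?leqW //.
  rewrite cats1 swap_rcons ?size_rcons //; congr (rcons (rcons _ _) _).
  case: (swap_atP c t a (rcons s0 p)) => // s1 x z s2 _ e d.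
  by rewrite -d (row_dist _ _ _ _ e) in a1.
have X0 q : ext K1 q -> linked #|K1|.+1 (rcons q0 v) (rcons q v).
  case/lastP: q => [|q x] Lq; first by have := lin_ext_size Lq; rewrite sK.
  have [cx ax Lq'] := lin_ext_last lt_irr Lq.
  case: (cornK1 x cx) => ex; rewrite {x}ex in Lq cx ax Lq' *.
    have Ls : ext (K1 :\ p) (rcons s0 y).
      have := Lq1; rewrite (_ : _ ++ _ = rcons (rcons (rcons s0 y) p) v).
        case/(lin_ext_last lt_irr); rewrite addableU1 ?aK1.1 // => _ _.
        by case/(lin_ext_last lt_irr).
      by rewrite -!cats1 -!catA.
    apply: (lin_ext_connected lt_irr _ Ls Lq'
      (P := fun s => linked _ (rcons q0 v) (rcons (rcons s p) v))); last first.
      by rewrite -[rcons (rcons s0 y) p]cats1.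
    move=> t1 x z t2 xz Lt H.
    have sm : size t1 < m.
      have := lin_ext_size Lt; rewrite -(lin_ext_size Ls) size_rcons size_cat /=.
      by rewrite -/m; lia.
    have tK : (size t1).+1 < #|K1|.+1 by rewrite sK; lia.
    have := linked_swap tK (incomp_dist xz) H; rewrite fix0 ?incomp_dist //.
    by rewrite !rcons_cat /= swap_at_cat eqxx.
  have Ls : ext (K1 :\ y) (rcons s0 p).
    by have := Lq0; rewrite /q0 cats1; case/(lin_ext_last lt_irr).
  apply: (lin_ext_connected lt_irr _ Ls Lq'
    (P := fun s => linked _ (rcons q0 v) (rcons (rcons s y) v))); last first.
    by left; rewrite /q0 cats1.
  move=> t1 x z t2 xz Lt _; case: (row_chain x z _ _ xz).
    by rewrite Ls.2 -Lt.2 mem_cat !inE eqxx orbT.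
  by rewrite Ls.2 -Lt.2 mem_cat !inE eqxx !orbT.
have linkK := @linked_addable _ _ iK1 aK1.
split; first exact: ideal_addable.
  by exists q1, q2, q3.
move=> r1 r2 r3 unr Lr1 Lr2 Lr3; rewrite cK.
have HX r r' : ext K1 r -> ext K1 r' -> linked #|K1|.+1 (rcons r v) (rcons r' v).
  by move=> Lr Lr'; apply: linked_trans (X0 _ Lr'); apply/linked_sym/X0.
have HC l : corner lt (v |: K1) l -> l != v ->
    exists l', [/\ corner lt K1 l', l' != l & dist l' v != dist l v].
  move=> cl nlv; have [nyp nyp1 nyp2] := yp.
  have clK : corner lt K1 l.
    split=> [|z zK]; first by have := cl.1; rewrite !inE (negbTE nlv).
    by apply: cl.2; rewrite inE zK orbT.
  have [cy cp] : corner lt K1 y /\ corner lt K1 p.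
    have Lpy : ext K1 (rcons (rcons s0 p) y) by rewrite -cats1.
    have Lyp : ext K1 (rcons (rcons s0 y) p).
      rewrite -!cats1 -catA /=; apply: lin_ext_swap (_ : ext K1 (s0 ++ [:: p; y])) => //.
      by move: Lq0; rewrite /q0 cat_rcons.
    by split; [case: (lin_ext_last lt_irr Lpy)|case: (lin_ext_last lt_irr Lyp)].
  case: (cornK1 l clK) => ->; first by exists y.
  by exists p; rewrite 1?eq_sym (eq_sym (dist p v)).
by apply: linked_C3 => //; apply: linkK.
Qed.

(** Permutations are composed from left to right, so the product of the two transpositions is the
    cycle sending [T1] to [T2], [T2] to [T3] and [T3] to [T1]. *)
Lemma alternating_full : alternating [set: B] ->
  forall T1 T2 T3 : X, uniq [:: T1; T2; T3] -> (tperm T1 T2 * tperm T1 T3 \in G)%g.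
Proof.
case=> _ _ HG T1 T2 T3 un; have unw : uniq [:: word T1; word T2; word T3].
  by rewrite -(map_inj_uniq word_inj) in un.
have [_ _ [u uG Hu]] := HG _ _ _ unw (word_lin T1) (word_lin T2) (word_lin T3).
have wu T : word (u T) = rot3 (word T1) (word T2) (word T3) (word T).
  have sT := lin_ext_size (word_lin T).
  by rewrite Hu /on_prefix take_oversize ?sT // drop_oversize ?sT // cats0.
move: un unw; rewrite /= !inE !negb_or !andbT => /andP[/andP[n12 n13] n23] /andP[/andP[w12 w13] w23].
rewrite (_ : (_ * _)%g = u) //; apply/permP => T; apply: word_inj; rewrite wu permM.
have [->|n1] := eqVneq T T1; first by rewrite tpermL tpermD ?rot3_1 // eq_sym.
have [->|n2] := eqVneq T T2; first by rewrite tpermR tpermL rot3_2.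
have [->|n3] := eqVneq T T3; first by rewrite (tpermD n13 n23) tpermR rot3_3.
rewrite rot3_id ?(inj_eq word_inj) //; move: n1 n2 n3; rewrite !(eq_sym T) => n1 n2 n3.
by rewrite (tpermD n1 n2) (tpermD n1 n3).
Qed.

End Growth.

(** * From three-cycles to the alternating group *)

Section ThreeCycles.
Context (X : finType) (G : {group {perm X}}).
Hypothesis cyc3 : forall a b d : X, uniq [:: a; b; d] -> (tperm a b * tperm a d \in G)%g.

(** Inserting [tperm a d] twice between the two transpositions splits the product into two pairs
    which share a point each. *)
Lemma tperm2_in (a b d e : X) : a != b -> d != e -> (tperm a b * tperm d e \in G)%g.
Proof.
move=> nab nde.
have share x y z : x != y -> x != z -> (tperm x y * tperm x z \in G)%g.
  move=> nxy nxz; have [->|nyz] := eqVneq y z; first by rewrite tperm2 group1.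
  by apply: cyc3; rewrite /= !inE !negb_or nxy nxz nyz.
have [ead|nad] := eqVneq a d; first by rewrite -ead in nde *; apply: share.
have -> : (tperm a b * tperm d e = (tperm a b * tperm a d) * (tperm d a * tperm d e))%g.
  by rewrite (tpermC d a) mulgA -(mulgA (tperm a b)) tperm2 mulg1.
by rewrite groupM // share // eq_sym.
Qed.

Lemma Alt_sub : ('Alt_X \subset G)%g.
Proof.
apply/subsetP => s; rewrite Alt_even; case: (prod_tpermP s) => ts -> {s}.
have [n] := ubnP (size ts); elim: n ts => // n IH [|t1 [|t2 ts]] /= ltn.
- by rewrite big_nil group1.
- by rewrite big_seq1 odd_tperm => /andP[-> _].
case/and3P=> d1 d2 dts; rewrite !big_cons mulgA !odd_permM !odd_tperm.
rewrite (d1 : t1.1 != t1.2) (d2 : t2.1 != t2.2) /= => sE.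
by rewrite groupM ?tperm2_in ?IH //; lia.
Qed.

Lemma Alt_or_Sym : G = ('Alt_X)%g :> {set _} \/ G = ('Sym_X)%g :> {set _}.
Proof.
have [sub|/subsetPn[u uG nu]] := boolP (G \subset ('Alt_X)%g).
  by left; apply/eqP; rewrite eqEsubset sub Alt_sub.
right; apply/setP => s; rewrite [RHS]inE.
have uo : odd_perm u by move: nu; rewrite Alt_even negbK.
have [se|so] := boolP (odd_perm s).
  rewrite -(mulgKV u s) groupM // (subsetP Alt_sub) // Alt_even.
  by rewrite odd_permM odd_permV se uo.
by rewrite (subsetP Alt_sub) // Alt_even.
Qed.

End ThreeCycles.

(** * Skew diagrams *)

Section Shape.
Context (B : finType) (row col : B -> nat) (r : nat) (L R : nat -> nat).
Hypothesis box_inj : forall x y, row x = row y -> col x = col y -> x = y.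
Hypothesis box_in : forall x, [/\ row x <= r, L (row x) <= col x & col x < R (row x)].
Hypothesis box_ex : forall i j, i <= r -> L i <= j -> j < R i ->
  exists x, row x = i /\ col x = j.
Hypothesis L_mono : forall i j, i <= j -> j <= r -> L j <= L i.
Hypothesis R_mono : forall i j, i <= j -> j <= r -> R j <= R i.
Implicit Types (x y v w : B).

Definition nw x y := [&& row x <= row y, col x <= col y & (row x != row y) || (col x != col y)].
Definition content x : int := ((col x)%:Z - (row x)%:Z)%R.

Local Notation dist := (cdist content).

Lemma distE x y : dist x y = ((col x + row y) - (col y + row x)) + ((col y + row x) - (col x + row y)).
Proof. rewrite /cdist /content; lia. Qed.

Lemma nw_irr : irreflexive nw.
Proof. by move=> x; rewrite /nw !eqxx !andbF. Qed.

Lemma nw_trans : transitive nw.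
Proof. move=> y x z; rewrite /nw; lia. Qed.

Lemma incompP x y : incomp nw x y ->
  (row x < row y /\ col y < col x) \/ (row y < row x /\ col x < col y).
Proof.
case=> nxy; rewrite /nw => h1 h2.
have : ~ (row x = row y /\ col x = col y).
  by case=> er ec; rewrite (box_inj er ec) eqxx in nxy.
lia.
Qed.

(** One of the boxes lies strictly north-east of the other, so rows and columns both add to the
    difference of contents. *)
Lemma incomp_dist x y : incomp nw x y -> 1 < dist x y.
Proof. by move/incompP; rewrite distE; lia. Qed.

(** As [L] and [R] weakly decrease downwards, the diagram contains the north-east corner of the
    rectangle spanned by two comparable boxes, and also the boxes between two boxes of one row or
    column. So a cover is an adjacent pair. *)
Lemma cover_dist x y : nw x y -> (forall z, nw x z -> ~~ nw z y) -> dist x y = 1.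
Proof.
move=> xy Hz; have [rx lx Rx] := box_in x; have [ry ly Ry] := box_in y.
have no i j : i <= r -> L i <= j -> j < R i -> row x <= i -> i <= row y ->
    col x <= j -> j <= col y -> (i, j) != (row x, col x) -> (i, j) != (row y, col y) -> False.
  move=> ir Li Ri h1 h2 h3 h4; rewrite !xpair_eqE => n1 n2.
  have [z [ez1 ez2]] := box_ex ir Li Ri.
  have := Hz z; rewrite /nw ez1 ez2; lia.
have {}no i j : i <= r -> L i <= j -> j < R i -> row x <= i -> i <= row y ->
    col x <= j -> j <= col y -> (i = row x /\ j = col x) \/ (i = row y /\ j = col y).
  move=> h1 h2 h3 h4 h5 h6 h7; case: (eqVneq (i, j) (row x, col x)) => [[]|n1]; first by left.
  by case: (eqVneq (i, j) (row y, col y)) => [[]|n2]; [right|case: (no i j)].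
move: xy; rewrite /nw => xy.
have Rxy : R (row y) <= R (row x) by apply: R_mono; lia.
have Lxy : L (row y) <= L (row x) by apply: L_mono; lia.
have := no (row x) (col y); have := no (row x) (col x).+1.
have : row x < row y -> L (row x).+1 <= L (row x) /\ R (row y) <= R (row x).+1.
  by move=> h; split; [apply: L_mono|apply: R_mono]; lia.
have := no (row x).+1 (col x).
rewrite distE; lia.
Qed.

(** Row 0 is left out because the chain of ideals starts with the whole top row. *)
Lemma top_exists j : 0 < r -> L r <= j ->
  exists i, [/\ 1 <= i <= r, L i <= j & forall i', 1 <= i' < i -> j < L i'].
Proof.
move=> r0 Lj; have ex : exists i, (1 <= i <= r) && (L i <= j) by exists r; lia.
case: (ex_minnP ex) => i /andP[hi Li] mini; exists i; split=> // i' hi'.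
by rewrite ltnNge; apply/negP => Li'; have := mini i'; lia.
Qed.

(** The columns from [L 0] to [R r - 1] meet all rows, so there are at least [r + 2] full
    columns. *)
Hypothesis wide : L 0 + r + 2 <= R r.
Hypothesis r_gt1 : 1 < r.
Context (X : finType) (G : {group {perm X}}) (word : X -> seq B).
Hypothesis word_inj : injective word.
Hypothesis word_lin : forall T, lin_ext nw [set: B] (word T).
Hypothesis swapsG : forall t a, 1 < a ->
  exists2 u, u \in G & forall T, word (u T) = swap_at content t a (word T).

Local Notation ext := (lin_ext nw).
Local Notation alternating := (alternating nw G word).
Local Notation addable := (addable nw).
Local Notation corner := (corner nw).

Context (p y1 v2 : B) (j1 j2 : nat).
Hypothesis p_row : row p = 0.
Hypothesis p_col : col p = (R 0).-1.
Hypothesis y1_row : row y1 = j1.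
Hypothesis y1_col : col y1 = L r.
Hypothesis v2_row : row v2 = j2.
Hypothesis v2_col : col v2 = (L r).+1.
Hypothesis j1_top : [/\ 1 <= j1 <= r, L j1 <= L r & forall i, 1 <= i < j1 -> L r < L i].
Hypothesis j2_top : [/\ 1 <= j2 <= r, L j2 <= (L r).+1 & forall i, 1 <= i < j2 -> (L r).+1 < L i].

(** * Filling the diagram column by column *)

Lemma col_max x : col x <= (R 0).-1.
Proof. have [rx _ cx] := box_in x; have := R_mono (leq0n (row x)) rx; lia. Qed.

Lemma col_min x : L r <= col x.
Proof. have [rx cx _] := box_in x; have := L_mono rx (leqnn r); lia. Qed.

Lemma bounds i : i <= r -> [/\ L r <= L i, L i <= L 0, R r <= R i & R i <= R 0].
Proof. by move=> ir; split; [apply: L_mono|apply: L_mono|apply: R_mono|apply: R_mono]. Qed.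

Lemma box_neq x y : x != y -> row x != row y \/ col x != col y.
Proof.
move=> nxy; case: (eqVneq (row x) (row y)) => [er|]; last by left.
by case: (eqVneq (col x) (col y)) => [ec|]; [rewrite (box_inj er ec) eqxx in nxy|right].
Qed.

Lemma addable_lt K w x : addable K w -> nw x w -> x \in K.
Proof. by case=> _; apply. Qed.

Lemma addable_not_nw K v w : addable K v -> addable K w -> ~~ nw v w.
Proof. by case=> nv _ [_ Hw]; apply/negP => /Hw; rewrite (negbTE nv). Qed.

(** This is [alternating_step] with [l := p]. Addable boxes lie below the top row and have smaller
    content than [p]; two of them at the same distance from [p] would lie on one diagonal and be
    comparable. *)
Lemma grow K v l2 : alternating K -> addable K v ->
    (forall x, row x = 0 -> x \in K) -> y1 \in K -> v2 \in K ->
    (forall x, x \in K -> 0 < row x -> col x < (R 0).-1) ->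
    col v < (R 0).-1 -> corner K l2 ->
    (forall w, addable K w -> dist l2 w != dist p v) ->
  alternating (v |: K).
Proof.
move=> gK aK row0K y1K v2K Kcol vcol cl2 Hl2.
have [iK _ _] := gK.
have row_pos w : addable K w -> 0 < row w.
  by case=> nwK _; rewrite lt0n; apply: contraNneq nwK => /row0K.
have rv := row_pos v aK; have cv := col_max v.
have pK := row0K p p_row.
have cp (K' : {set B}) : K' \subset K -> p \in K' -> corner K' p.
  move=> /subsetP sK pK'; split=> // x /sK xK; rewrite /nw p_row p_col.
  have := col_max x; have := Kcol x xK; lia.
have l2p : l2 != p by apply/eqP => e; have := Hl2 v aK; rewrite e eqxx.
apply: (alternating_step nw_irr nw_trans incomp_dist cover_dist word_inj word_lin swapsG
  gK aK (cp K (subxx K) pK) cl2) => //.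
- by rewrite distE p_row p_col; lia.
- move=> w aw /box_neq nwv; have := addable_not_nw aK aw; have := addable_not_nw aw aK.
  have := row_pos w aw; have := col_max w; have [rw _ _] := box_in w; have [rv' _ _] := box_in v.
  by rewrite /nw !distE p_row p_col; lia.
have [ae ie] := corner_addable nw_irr iK cl2.
(* [K :\ l2] has two linear extensions: one ends in [p], the other in a corner below the top row,
   which exists because [y1] or [v2] remains. *)
have [e eK re] : exists2 e, e \in K :\ l2 & 0 < row e.
  have [j1p _ _] := j1_top; have [j2p _ _] := j2_top.
  have [ey|ny] := eqVneq y1 l2.
    by exists v2; rewrite ?v2_row ?inE ?v2K ?andbT;
      [apply/eqP => e; have := v2_col; rewrite e -ey y1_col; lia|lia].
  by exists y1; rewrite ?y1_row ?inE ?ny ?y1K //; lia.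
have [d cd ed] := corner_above nw_irr nw_trans eK.
have rd : 0 < row d by case: ed => [->//|]; rewrite /nw; lia.
have pK' : p \in K :\ l2 by rewrite !inE eq_sym l2p.
have cp' := cp _ (subsetDl _ _) pK'.
have [ap ip] := corner_addable nw_irr ie cp'; have [ad id] := corner_addable nw_irr ie cd.
have [q Lq] := lin_ext_exists nw_irr nw_trans ip.
have [q' Lq'] := lin_ext_exists nw_irr nw_trans id.
exists (rcons q p), (rcons q' d); split.
- by rewrite -(setD1K pK'); apply: lin_ext_rcons.
- by rewrite -(setD1K cd.1); apply: lin_ext_rcons.
- by rewrite eqseq_rcons negb_and orbC; apply/orP; left; apply: contraTneq rd => <-; rewrite p_row.
Qed.

(* The ideals of the column-by-column filling; [v2] is added ahead of its turn, because
   the base case needs it. *)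
Definition stage c k : {set B} :=
  [set x | [|| row x == 0, x == v2, col x < c | (col x == c) && (row x < k)]].

Lemma stageE c k x : (x \in stage c k) =
  [|| row x == 0, (row x == j2) && (col x == (L r).+1), col x < c | (col x == c) && (row x < k)].
Proof.
rewrite inE (_ : (x == v2) = (row x == j2) && (col x == (L r).+1)) //.
apply/eqP/andP => [->|[/eqP ej /eqP el]]; first by rewrite v2_row v2_col.
by apply: box_inj; rewrite ?v2_row ?v2_col.
Qed.

Lemma j2_le_j1 : j2 <= j1.
Proof.
have [h1 h2 _] := j1_top; have [_ _ h3] := j2_top.
by rewrite leqNgt; apply/negP => h; have := h3 j1; lia.
Qed.

Lemma nwP x y : nw x y ->
  row x <= row y /\ col x <= col y /\ (row x < row y \/ col x < col y).
Proof. by rewrite /nw => /and3P[h1 h2 h3]; do 2!split=> //; lia. Qed.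

Lemma stage_addable c k v : 0 < k -> row v = k -> col v = c -> v != v2 -> addable (stage c k) v.
Proof.
move=> k0 rv cv nv2; split=> [|z /nwP]; last by rewrite stageE; lia.
by rewrite inE (negbTE nv2); lia.
Qed.

Lemma stage_addable_after c k w : addable (stage c k) w ->
  [/\ 0 < row w, c <= col w & col w = c -> k <= row w].
Proof. by case=> nwK _; move: nwK; rewrite stageE => nwK; split; lia. Qed.

(** In the last column [v] is the only addable box. The box above it is a corner at distance 1, and
    every other corner that survives the addition of [v] is incomparable to [v], hence farther
    away. *)
Lemma stage_forced c k v : 0 < k -> row v = k -> col v = c -> v != v2 ->
  c = (R 0).-1 -> alternating (stage c k) -> alternating (v |: stage c k).
Proof.
move=> k0 rv cv nv2 ec gK; have aK := stage_addable k0 rv cv nv2.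
have [rr lv Rv] := box_in v.
apply: (alternating_forced nw_irr nw_trans incomp_dist cover_dist word_lin swapsG gK aK).
  move=> w aw; have [rw cw kw] := stage_addable_after aw.
  have := addable_not_nw aK aw; have := col_max w; rewrite /nw => h1 h2.
  by apply: box_inj; lia.
move=> l cl nlv; have [iK _ _] := gK.
have [l1 l2 l3 l4] := bounds rr; have rr1 : k.-1 <= r by lia.
have [m1 m2 m3 m4] := bounds rr1.
have m5 : R k <= R k.-1 by apply: R_mono; lia.
have [l' [rl cl']] : exists x, row x = k.-1 /\ col x = c by apply: box_ex; rewrite rv in Rv; lia.
have l'v : nw l' v by rewrite /nw; lia.
have lK : l \in stage c k by have := cl.1; rewrite in_setU1 (negbTE nlv).
have lv2 : 1 < dist l v.
  apply: incomp_dist; split=> //; first by apply: cl.2; rewrite setU11.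
  by apply/negP => /(iK _ _ lK); rewrite (negbTE aK.1).
exists l'; split.
- split=> [|x xK]; first by rewrite stageE; lia.
  apply/negP => /nwP; have := col_max x; move: xK; rewrite stageE; lia.
- by apply: contraTneq l'v => ->; apply: cl.2; rewrite setU11.
- by apply/eqP => e; rewrite -e distE in lv2; lia.
Qed.

Lemma stage_grow c k v l2 : L r <= c -> (c = L r -> j1 < k) -> 0 < k ->
    row v = k -> col v = c -> v != v2 -> c < (R 0).-1 -> alternating (stage c k) ->
    corner (stage c k) l2 -> (forall w, addable (stage c k) w -> dist l2 w != dist p v) ->
  alternating (v |: stage c k).
Proof.
move=> Lc cj k0 rv cv nv2 cR gK cl2 Hl2; have aK := stage_addable k0 rv cv nv2.
apply: (grow gK aK) cl2 Hl2; rewrite ?cv //.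
- by move=> x rx; rewrite stageE rx eqxx.
- by rewrite stageE y1_row y1_col; lia.
- by rewrite stageE v2_row v2_col !eqxx orbT.
- move=> x; rewrite stageE; have [rr] := box_in v; have [] := bounds (leq0n r); lia.
Qed.

(** When the box above [v] lies in the diagram, every addable box has at least the content of [v]. A
    corner with content strictly between those of [v] and [p] is then closer to every addable box
    than [p] is to [v]. *)
Lemma stage_grow_below c k v : L r <= c -> (c = L r -> j1 < k) -> 1 < k -> L k.-1 <= c ->
    row v = k -> col v = c -> v != v2 -> c < (R 0).-1 -> alternating (stage c k) ->
  alternating (v |: stage c k).
Proof.
move=> Lc cj k1 Lk rv cv nv2 cR gK; have k0 : 0 < k by lia.
have aK := stage_addable k0 rv cv nv2; have [rr lv Rv] := box_in v; rewrite rv cv in rr lv Rv.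
have [hj1 hj1' hj1''] := j1_top; have [hj2 hj2' hj2''] := j2_top; have jj := j2_le_j1.
have low w : addable (stage c k) w -> c + row w <= col w + k.
  move=> aw; have [rw cw kw] := stage_addable_after aw.
  have [rrw lw Rw] := box_in w.
  have nvw := addable_not_nw aK aw; rewrite leqNgt; apply/negP => h.
  have kw' : k < row w by move: nvw; rewrite /nw; lia.
  have Lkw : L (row w) <= L k by apply: L_mono; lia.
  have [z [rz cz]] : exists x, row x = row w /\ col x = c by apply: box_ex; move: nvw; rewrite /nw; lia.
  have zw : nw z w by move: nvw; rewrite /nw; lia.
  have := addable_lt aw zw; rewrite stageE => zK.
  have := hj2'' k; lia.
have Hl2 l2 : c + row l2 < col l2 + k -> col l2 < (R 0).-1 ->
    forall w, addable (stage c k) w -> dist l2 w != dist p v.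
  move=> hl h2 w aw; have := low w aw; have := col_max w; have [rw cw kw] := stage_addable_after aw.
  by rewrite !distE p_row p_col rv cv; lia.
(* The box above [v] is such a corner, unless [v2], added early, is its right neighbour; then [v2]
   takes its place. *)
have [/andP[/eqP ec /eqP ej]|ne] := boolP ((c == L r) && (j2 == k.-1)).
  apply: (@stage_grow c k v v2) => //; last first.
    have [b1 b2 b3 b4] := bounds (leqnn r).
    by apply: Hl2; rewrite ?v2_row v2_col; lia.
  split=> [|x]; first by rewrite stageE v2_row v2_col !eqxx orbT.
  by rewrite stageE => xK; apply/negP => /nwP; rewrite v2_row v2_col; lia.
have R1 : R k <= R k.-1 by apply: R_mono; lia.
have [l2 [rl cl]] : exists x, row x = k.-1 /\ col x = c by apply: box_ex; lia.
apply: (@stage_grow c k v l2) => //; last first.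
  by apply: Hl2; lia.
split=> [|x]; first by rewrite stageE; lia.
rewrite stageE => xK; apply/negP => /nwP; have := hj2'' k.-1; lia.
Qed.

(** The second corner is the bottom box of column [c - 1]. The addable boxes lie in the columns from
    [c] to [L 0], and by [wide] they are closer to it than [p] is to [v]. *)
Lemma stage_grow_top_left c k v : (L r).+1 < c -> c < L 0 -> 0 < k ->
    (1 < k -> c < L k.-1) -> row v = k -> col v = c -> v != v2 -> alternating (stage c k) ->
  alternating (v |: stage c k).
Proof.
move=> Lc cL k0 Lk rv cv nv2 gK.
have aK := stage_addable k0 rv cv nv2; have [rr lv Rv] := box_in v; rewrite rv cv in rr lv Rv.
have [b1 b2 b3 b4] := bounds (leqnn r); have [b1' b2' b3' b4'] := bounds (leq0n r).
have [l2 [rl cl]] : exists x, row x = r /\ col x = c.-1 by apply: box_ex; lia.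
apply: (@stage_grow c k v l2) => //; try lia.
  split=> [|x]; first by rewrite stageE; lia.
  by rewrite stageE => xK; apply/negP => /nwP; have [rx _ _] := box_in x; lia.
move=> w aw; have [rw cw kw] := stage_addable_after aw; have [rrw lw Rw] := box_in w.
have [d1 d2 d3 d4] := bounds rrw.
suff : col w <= L 0 by rewrite !distE p_row p_col; lia.
rewrite leqNgt; apply/negP => h.
have [z [rz cz]] : exists x, row x = row w /\ col x = (col w).-1 by apply: box_ex; lia.
have zw : nw z w by rewrite /nw; lia.
have := addable_lt aw zw; rewrite stageE; lia.
Qed.

Lemma addable_col_le K w c : addable K w -> L (row w) <= c ->
    (forall x, row x = row w -> col x = c -> x \notin K) ->
  col w <= c.
Proof.
move=> aw Lc out; rewrite leqNgt; apply/negP => cw; have [rw _ Rw] := box_in w.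
have [x [rx cx]] := box_ex rw Lc (ltn_trans cw Rw).
have /negP := out x rx cx; apply; apply: (addable_lt aw).
by rewrite /nw rx cx; clear - cw; lia.
Qed.

(* [p] and the last box [y] of column [c - 1] have the same distance to [v]; therefore [v]
   is added before [y]. *)
Lemma stage_grow_reflected c v : c + r = R 0 -> c <= R r -> L 0 + 1 < c -> c < (R 0).-1 ->
    row v = 1 -> col v = c -> v != v2 -> alternating (stage c.-1 r) ->
  alternating (v |: stage c 1).
Proof.
move=> cE Rc Lc cR rv cv nv2 gK'; pose K := stage c.-1 r.
have [b1 b2 b3 b4] := bounds (leqnn r).
have c0 : 0 < c by clear - Lc; lia.
have [y [ry cy]] : exists x, row x = r /\ col x = c.-1.
  by apply: box_ex; clear - b2 Lc Rc; lia.
have [_ f2 f3 _] := bounds (leq_pred r).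
have [l3 [rl cl]] : exists x, row x = r.-1 /\ col x = c.-1.
  by apply: box_ex; clear - f2 f3 Lc Rc; lia.
have v2c x : x = v2 -> row x = j2 /\ col x < c /\ (col x = c.-1 -> j2 <= 1).
  move=> ->; have [h1 h2 h3] := j2_top; rewrite v2_row v2_col.
  have [_ L1 _ _] := bounds (ltnW r_gt1); have := h3 1.
  by clear - h1 b2 Lc L1; lia.
have nyv2 : y != v2 by apply/eqP => /v2c; rewrite ry cy; clear - r_gt1; lia.
have yv : y != v by apply/eqP => e; rewrite e in ry; clear - ry rv r_gt1; lia.
have inK x : x \in K -> row x = 0 \/ col x < c.-1 \/ (col x = c.-1 /\ row x < r).
  rewrite inE => /or4P[/eqP->|/eqP/v2c h|->|/andP[/eqP-> ->]]; auto.
  by right; clear - h r_gt1; lia.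
have Kin x : row x = 0 \/ col x < c.-1 \/ (col x = c.-1 /\ row x < r) -> x \in K.
  by rewrite inE => -[->|[->|[-> ->]]]; rewrite ?eqxx ?orbT.
have y1K : y1 \in K by apply: Kin; rewrite y1_col; clear - b2 Lc; lia.
have v2K : v2 \in K by rewrite inE eqxx orbT.
have aKv : addable K v.
  split=> [|z /nwP]; first by apply/negP => /inK; rewrite rv cv; clear - c0; lia.
  by rewrite rv cv => h; apply: Kin; clear - h r_gt1; lia.
have aK_col w : addable K w -> [/\ 0 < row w <= r, c.-1 <= col w & col w <= c].
  move=> aw; have [rw cw _] := stage_addable_after aw; have [rrw _ _] := box_in w.
  have [_ Lw _ _] := bounds rrw; split=> //; first by rewrite rw.
  apply: addable_col_le aw _ _; first by clear - Lw Lc; lia.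
  by move=> x rx cx; apply/negP => /inK; rewrite rx cx; clear - rw c0; lia.
(* The corner is [l3], the box above [y]: its distances to [y] and [v] are 1 and [r - 1], while
   [dist p v] is [r]. *)
have gKv : alternating (v |: K).
  apply: (grow gK' aKv) (_ : corner K l3) _ => //.
  - by move=> x rx; apply: Kin; left.
  - by move=> x /inK; clear - cR; lia.
  - by rewrite cv.
  - split=> [|x /inK xK]; first by apply: Kin; rewrite rl cl; clear - r_gt1; lia.
    apply/negP => /nwP; rewrite rl cl; clear - xK r_gt1; lia.
  - move=> w aw; have [rw cw cw'] := aK_col w aw; have := addable_not_nw aKv aw.
    have := aw.1 => nK; have wK : ~ (row w < r /\ col w = c.-1).
      by move=> [h1 h2]; move/negP: nK; apply; apply: Kin; right; right.
    rewrite /nw !distE p_row p_col rv cv rl cl => nvw.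
    by clear - nvw wK rw cw cw' cE c0 r_gt1 cR; lia.
have aKy : addable (v |: K) y.
  split=> [|z /nwP].
    by rewrite in_setU1 (negbTE yv); apply/negP => /inK; rewrite ry cy; clear - r_gt1 c0; lia.
  rewrite ry cy in_setU1 => h; rewrite Kin ?orbT //; have [rz _ _] := box_in z.
  by clear - h rz; lia.
have -> : v |: stage c 1 = y |: (v |: K).
  apply/setP => x; rewrite !in_setU1.
  have [->|nxv] := eqVneq x v; first by rewrite orbT.
  have [->|nxy] /= := eqVneq x y; first by rewrite stageE cy; clear - c0; lia.
  have [rx _ _] := box_in x; have := box_neq nxy; rewrite ry cy => n.
  apply/idP/idP => [|/inK xK].
    rewrite inE => /or4P[/eqP h|/eqP->|h|h]; [by apply: Kin; left|by []|apply: Kin|apply: Kin].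
      by clear - h n rx; lia.
    by clear - h; lia.
  by rewrite stageE; clear - xK c0; lia.
(* Now [v] is the corner: all addable boxes are within distance [r] of it, while [dist p y] is
   [2 * r]. *)
apply: (grow gKv aKy) (_ : corner (v |: K) v) _; rewrite ?in_setU1 ?y1K ?v2K ?orbT //.
- by move=> x rx; rewrite in_setU1 Kin ?orbT //; left.
- by move=> x; rewrite in_setU1 => /predU1P[->|/inK]; rewrite ?cv //; clear - cR; lia.
- by rewrite cy; clear - cR; lia.
- split=> [|x]; first by rewrite setU11.
  rewrite in_setU1 => /predU1P[->|/inK xK]; first by rewrite nw_irr.
  by apply/negP => /nwP; rewrite rv cv; clear - xK c0; lia.
move=> w aw; have [rrw _ _] := box_in w; have [_ Lw _ _] := bounds rrw.
have [nw1 nw2] : 0 < row w /\ c.-1 <= col w.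
  have := aw.1; rewrite in_setU1 negb_or => /andP[_ nK].
  split; rewrite ltnNge || rewrite leqNgt; apply/negP => h; move/negP: nK; apply; apply: Kin.
    by clear - h; lia.
  by right; left.
have cw : col w <= c.+1.
  apply: addable_col_le aw _ _; first by clear - Lw Lc; lia.
  move=> x rx cx; rewrite in_setU1 negb_or; apply/andP; split.
    by apply/eqP => e; rewrite e cv in cx; clear - cx; lia.
  by apply/negP => /inK; rewrite rx cx; clear - nw1; lia.
by rewrite !distE p_row p_col rv cv ry cy; clear - cw nw1 nw2 rrw cE r_gt1 c0; lia.
Qed.

(** As [v] is the only addable box, any corner works whose distance to [v] differs from that of [p].
    The first candidate is the bottom box of column [c - 1], the second one the end of the bottom
    row; the reflected rectangle remains when column [c - 1] reaches row [r]. *)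
Lemma stage_grow_top_right c v : (L r).+1 < c -> L 0 <= c -> c < (R 0).-1 ->
    row v = 1 -> col v = c -> v != v2 -> alternating (stage c 1) -> alternating (stage c.-1 r) ->
  alternating (v |: stage c 1).
Proof.
move=> Lc cL cR rv cv nv2 gK gK'.
have aK := stage_addable (ltn0Sn 0) rv cv nv2.
have [_ lv Rv] := box_in v; rewrite rv cv in lv Rv.
have [b1 b2 b3 b4] := bounds (leqnn r); have [b1' b2' b3' b4'] := bounds (leq0n r).
have only w : addable (stage c 1) w -> w = v.
  move=> aw; have [rw cw kw] := stage_addable_after aw.
  have := addable_not_nw aK aw; rewrite /nw => nvw.
  have [rrw lw Rw] := box_in w; have [d1 d2 d3 d4] := bounds rrw.
  have [z [rz cz]] : exists x, row x = row w /\ col x = c by apply: box_ex; lia.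
  have [e|ne] := eqVneq (col w) c; first by apply: box_inj; lia.
  have /(addable_lt aw) : nw z w by rewrite /nw; lia.
  by rewrite stageE; lia.
have step l2 : corner (stage c 1) l2 -> dist l2 v != dist p v -> alternating (v |: stage c 1).
  by move=> cl2 dl2; apply: (@stage_grow c 1 v l2) => //; [lia|lia|move=> w /only->].
have ex : exists b, (1 <= b <= r) && (c <= R b) by exists 1; lia.
have ub b : (1 <= b <= r) && (c <= R b) -> b <= r by lia.
case: (ex_maxnP ex ub) => b /andP[rb Rb] bmax.
have [e1 e2 e3 e4] : [/\ L r <= L b, L b <= L 0, R r <= R b & R b <= R 0] by apply: bounds; lia.
have Rr_b : R r < c -> b < r.
  by move=> h; rewrite ltn_neqAle (_ : b <= r) ?andbT; [apply: contraTneq Rb => ->; lia|lia].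
have b_Rr : b < r -> R r < c.
  by move=> h; rewrite ltnNge; apply/negP => h'; have := bmax r; lia.
(* The bottom box of column [c - 1] lies in row [b] and has distance [b] to [v]; [p] has distance
   [R 0 - c]. *)
have [bE|bN] := eqVneq b (R 0 - c); last first.
  have [l2 [rl cl]] : exists x, row x = b /\ col x = c.-1.
    apply: box_ex; [lia| |lia]; have := eqVneq b r.
    by case=> [->|nb]; [lia|have : b < r by lia]; move/b_Rr; lia.
  apply: (step l2); last by rewrite !distE p_row p_col; lia.
  split=> [|x]; first by rewrite stageE; lia.
  rewrite stageE => xK; apply/negP => /nwP h; have [rx lx Rx] := box_in x.
  have := bmax (row x); lia.
have [bltr|ber] : b < r \/ b = r by lia.
  have Rc := b_Rr bltr.
  have [l2 [rl cl]] : exists x, row x = r /\ col x = (R r).-1 by apply: box_ex; lia.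
  apply: (step l2); last by rewrite !distE p_row p_col; lia.
  split=> [|x _]; first by rewrite stageE; lia.
  apply/negP => /nwP h; have [rx lx Rx] := box_in x.
  have er : row x = r by lia.
  by rewrite er in Rx; lia.
rewrite ber in bE Rb; apply: stage_grow_reflected => //; clear - bE Rb wide b4 cR; lia.
Qed.

(** If [v] is not in the last column and has no box above it other than possibly one in the top row,
    its column is to the right of the two leftmost ones, because [y1] and [v2] are already present.
    Then [L 0] separates the last two cases. *)
Lemma stage_step c k v : L r <= c -> (c = L r -> j1 < k) -> 0 < k ->
    row v = k -> col v = c -> v != v2 -> alternating (stage c k) ->
    ((L r).+1 < c -> alternating (stage c.-1 r)) ->
  alternating (v |: stage c k).
Proof.
move=> Lc cj k0 rv cv nv2 gK gK'.
have [rr lv Rv] := box_in v; rewrite rv cv in rr lv Rv.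
have [ec|nc] := eqVneq c (R 0).-1; first exact: stage_forced.
have cR : c < (R 0).-1 by have := col_max v; lia.
have [hA|hB] := boolP ((1 < k) && (L k.-1 <= c)).
  by case/andP: hA => h1 h2; apply: stage_grow_below.
have [hj1 hj1' hj1''] := j1_top; have [hj2 hj2' hj2''] := j2_top; have jj := j2_le_j1.
have kj1 : j1 < k -> L k.-1 <= L j1 by move=> h; apply: L_mono; lia.
have kj2 : j2 < k -> L k.-1 <= L j2 by move=> h; apply: L_mono; lia.
have := hj2'' k => kj2'.
have Lc1 : (L r).+1 < c.
  have : ~ (k = j2 /\ c = (L r).+1).
    case=> e1 e2; move/negP: nv2; apply; apply/eqP/box_inj; rewrite ?v2_row ?v2_col; lia.
  by lia.
have [cL|Lc0] := ltnP c (L 0).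
  by apply: stage_grow_top_left => //; lia.
have k1 : k = 1.
  by have [_ h _ _] : [/\ L r <= L k.-1, L k.-1 <= L 0, R r <= R k.-1 & R k.-1 <= R 0]; [apply: bounds|]; lia.
by rewrite k1 in rv gK *; apply: stage_grow_top_right => //; apply: gK'.
Qed.

Lemma alternating_stages : alternating (stage (L r) j1.+1) -> alternating [set: B].
Proof.
move=> g0; have [hj1 hj1' hj1''] := j1_top.
have next c k : alternating (stage c k) -> L r <= c -> (c = L r -> j1 < k) -> 0 < k -> k <= r ->
    ((L r).+1 < c -> alternating (stage c.-1 r)) -> alternating (stage c k.+1).
  move=> gK Lc cj k0 kr prev.
  have [v /and3P[/eqP rv /eqP cv nv2]|none] := pickP [pred x | [&& row x == k, col x == c & x != v2]].
    rewrite (_ : stage c k.+1 = v |: stage c k); first exact: (stage_step Lc cj).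
    apply/setP => x; rewrite in_setU1 !stageE.
    have -> : (x == v) = (row x == k) && (col x == c).
      by apply/eqP/andP => [->|[/eqP h1 /eqP h2]]; [rewrite rv cv|apply: box_inj; lia].
    by lia.
  (* There is nothing to add: the position is outside the diagram or is that of [v2]. *)
  rewrite (_ : stage c k.+1 = stage c k) //; apply/setP => x.
  by have := none x; rewrite /= !inE; case: (x == v2); rewrite ?orbT ?andbT //=; lia.
suff H c : L r <= c -> forall k, 0 < k -> k <= r.+1 -> (c = L r -> j1 < k) -> alternating (stage c k).
  have [b1 b2 b3 b4] := bounds (leq0n r).
  have -> : [set: B] = stage (R 0) 1.
    by apply/setP => x; rewrite stageE inE; have := col_max x; have [_ _] := box_in x; lia.
  by apply: H; lia.
elim: c => [|c IH] Lc.
  elim=> [//|k IHk] _ kr cj; have [ek|] := eqVneq k j1.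
    by rewrite ek (_ : 0 = L r) //; lia.
  by move=> nk; apply: next; [apply: IHk|..]; lia.
have [Lc'|Lc'] : L r <= c \/ c.+1 = L r by lia.
  elim=> [//|k IHk] _ kr cj; have [ek|nk] := eqVneq k 0.
    (* A new column starts at [k = 1], since the top row belongs to every stage. *)
    rewrite ek (_ : stage c.+1 1 = stage c r.+1); first by apply: IH; lia.
    apply/setP => x; rewrite !stageE; have [rx _ _] := box_in x; lia.
  by apply: next => [||||| h /=]; [apply: IHk|..|apply: IH]; lia.
elim=> [//|k IHk] _ kr cj; have [ek|nk] := eqVneq k j1.
  by rewrite ek Lc'.
by apply: next; [apply: IHk|..]; lia.
Qed.

(** * Hooks and the start of the chain *)

Definition box i j : B := odflt p [pick x | (row x == i) && (col x == j)].

Lemma boxP i j : i <= r -> L i <= j -> j < R i -> row (box i j) = i /\ col (box i j) = j.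
Proof.
move=> ir Lj Rj; rewrite /box; case: pickP => [x /andP[/eqP-> /eqP->] //|no].
have [x [rx cx]] := box_ex ir Lj Rj.
by have := no x; rewrite rx cx !eqxx.
Qed.

Definition row0 n := [seq box 0 j | j <- iota (L 0) n].

Lemma row0S n : row0 n.+1 = rcons (row0 n) (box 0 (L 0 + n)).
Proof. by rewrite /row0 -addn1 iotaD map_cat cats1. Qed.

Lemma lin_ext_row0 n : L 0 + n <= R 0 ->
  ext [set x | (row x == 0) && (col x < L 0 + n)] (row0 n).
Proof.
elim: n => [|n IH] hn.
  split=> [|x]; first exact: lin_nil.
  rewrite inE; have [_ Lx _] := box_in x; symmetry; apply/negP => /andP[/eqP rx].
  by rewrite rx in Lx; lia.
have [rb cb] : row (box 0 (L 0 + n)) = 0 /\ col (box 0 (L 0 + n)) = L 0 + n by apply: boxP; lia.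
have aN : addable [set x | (row x == 0) && (col x < L 0 + n)] (box 0 (L 0 + n)).
  by split=> [|z /nwP]; rewrite inE rb cb; lia.
have := lin_ext_rcons (IH _) aN; rewrite -row0S => H.
case: H; first by lia.
move=> l m; split=> // x; rewrite m !inE.
have [->|nx] := eqVneq x (box 0 (L 0 + n)); first by rewrite rb cb /=; lia.
by rewrite /=; have := box_neq nx; rewrite rb cb; lia.
Qed.

Lemma row0_dist n t1 x z t2 : L 0 + n <= R 0 -> row0 n = t1 ++ x :: z :: t2 -> dist x z = 1.
Proof.
move=> hn e; have sz : n = size t1 + (size t2).+2.
  by have := congr1 size e; rewrite size_map size_iota size_cat.
have nth_row0 i : i < n -> nth p (row0 n) i = box 0 (L 0 + i).
  by move=> ilt; rewrite (nth_map 0) ?size_iota // nth_iota.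
have ex : x = box 0 (L 0 + size t1).
  by rewrite -nth_row0 ?e ?nth_cat ?ltnn ?subnn //; lia.
have ez : z = box 0 (L 0 + (size t1).+1).
  by rewrite -nth_row0 ?e ?nth_cat ?ltnNge ?leqnSn ?subSnn //; lia.
have [r1 c1] : row x = 0 /\ col x = L 0 + size t1 by rewrite ex; apply: boxP; lia.
have [r2 c2] : row z = 0 /\ col z = L 0 + (size t1).+1 by rewrite ez; apply: boxP; lia.
by rewrite distE; lia.
Qed.

(* The downset generated by [hi] and [lo] alone already has the size of [w]. *)
Lemma hook_downset (w : seq B) hi lo :
    uniq w -> (forall x z, x \in w -> nw z x -> z \in w) -> size w = (R 0 - L 0).+1 ->
    hi \in w -> lo \in w -> row hi < row lo -> col lo < col hi -> dist hi lo = dist y1 p ->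
  exists s, [/\ row hi = 0, col hi + s = (R 0).-1, col lo = L r, row lo = j1 + s &
    forall x, (x \in w) =
      ((row x == 0) && (col x <= col hi)) || ((col x == L r) && (0 < row x <= row lo))].
Proof.
move=> uw dw sw hiw low rlt clt; rewrite !distE y1_row y1_col p_row p_col => dE.
have [b1 b2 b3 b4] := bounds (leq0n r).
have [rhi lhi Rhi] := box_in hi; have [rlo llo Rlo] := box_in lo.
have cmin := col_min lo; have cmax := col_max hi.
have [hj1 hj1' hj1''] := j1_top.
have [jb [hjb hjb' hjb'']] := top_exists (ltnW r_gt1) cmin.
have jb_j1 : jb <= j1 by rewrite leqNgt; apply/negP => h; have := hjb'' j1; lia.
have jb_lo : jb <= row lo by rewrite leqNgt; apply/negP => h; have := hjb'' (row lo); lia.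
have Pr j : j \in iota (L 0) ((col hi).+1 - L 0) ->
    row (box 0 j) = 0 /\ col (box 0 j) = j.
  by rewrite mem_iota => hj; apply: boxP; lia.
have Pc i : i \in iota jb ((row lo).+1 - jb) ->
    row (box i (col lo)) = i /\ col (box i (col lo)) = col lo.
  rewrite mem_iota => hi'; have L1 : L i <= L jb by apply: L_mono; lia.
  have R1 : R (row lo) <= R i by apply: R_mono; lia.
  by apply: boxP; lia.
pose A := [seq box 0 j | j <- iota (L 0) ((col hi).+1 - L 0)] ++
          [seq box i (col lo) | i <- iota jb ((row lo).+1 - jb)].
have memA x : (x \in A) =
    ((row x == 0) && (col x <= col hi)) || ((col x == col lo) && (jb <= row x <= row lo)).
  have [rx lx Rx] := box_in x; rewrite mem_cat; congr (_ || _).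
    apply/mapP/idP => [[j hj ->]|/andP[/eqP rx0 cx]].
      by have [-> ->] := Pr j hj; move: hj; rewrite mem_iota; lia.
    have hj : col x \in iota (L 0) ((col hi).+1 - L 0) by rewrite mem_iota; rewrite rx0 in lx; lia.
    by exists (col x) => //; have [h1 h2] := Pr _ hj; apply: box_inj; rewrite ?h1 ?h2.
  apply/mapP/idP => [[i hi' ->]|/andP[/eqP cx rx']].
    by have [-> ->] := Pc i hi'; move: hi'; rewrite mem_iota; lia.
  have hi' : row x \in iota jb ((row lo).+1 - jb) by rewrite mem_iota; lia.
  by exists (row x) => //; have [h1 h2] := Pc _ hi'; apply: box_inj; rewrite ?h1 ?h2.
have uA : uniq A.
  rewrite cat_uniq; apply/and3P; split.
  - rewrite map_inj_in_uniq ?iota_uniq // => i j /Pr[_ e1] /Pr[_ e2] e.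
    by rewrite -e1 -e2 e.
  - apply/hasPn => x /mapP[i hi' ->]; apply/mapP => -[j hj e].
    have [h1 _] := Pr j hj; have [h2 _] := Pc i hi'.
    by rewrite -e h2 in h1; move: hi'; rewrite mem_iota; lia.
  - rewrite map_inj_in_uniq ?iota_uniq // => i j /Pc[e1 _] /Pc[e2 _] e.
    by rewrite -e1 -e2 e.
have sub : {subset A <= w}.
  move=> x; rewrite memA => hx; have [rx lx Rx] := box_in x.
  have [->//|nxh] := eqVneq x hi; have [->//|nxl] := eqVneq x lo.
  have := box_neq nxh; have := box_neq nxl => n1 n2.
  have [h|h] : (row x = 0 /\ col x <= col hi) \/ (col x = col lo /\ row x <= row lo).
    by clear - hx; lia.
    by apply: dw hiw _; rewrite /nw; clear - h n2; lia.
  by apply: dw low _; rewrite /nw; clear - h n1; lia.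
have sA : size A = ((col hi).+1 - L 0) + ((row lo).+1 - jb).
  by rewrite size_cat !size_map !size_iota.
have leA := uniq_leq_size uA sub; rewrite sA sw in leA.
(* By the distance equation [A] has at least [R 0 - L 0 + 1] boxes plus [row hi], [col lo - L r] and
   [j1 - jb]. As [A] fits into [w], these three nonnegative terms vanish. *)
have [e0 e1 e2] : [/\ row hi = 0, col lo = L r & jb = j1].
  by clear - leA dE jb_j1 jb_lo cmin cmax b1 b2 b4 rlt clt; split; lia.
have [|_ eqA] := uniq_min_size uA sub.
  by rewrite sA sw; clear - leA dE e0 e1 e2 jb_lo cmax b1 b2 rlt clt; lia.
(* The witness counts the boxes moved from the arm to the leg. *)
exists ((R 0).-1 - col hi); split=> //.
- by clear - cmax; lia.
- by clear - dE e0 e1 cmax rlt clt b1 b2; lia.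
move=> x; rewrite -eqA memA e1; have [rx lx Rx] := box_in x.
by have := hj1'' (row x); rewrite e2; clear - lx hj1; lia.
Qed.

(** The box [z] continues the arm, continues the leg, or is the first box below the top row in a
    column to the right of [L r]. In the last case its content is at least that of [v2], with
    equality only at [v2], which settles [hi]; and by [wide] it is too close to [lo]. The other two
    cases give distances that are too small or too large. *)
Lemma next_after_hook (w : seq B) hi lo z s :
    row hi = 0 -> col hi + s = (R 0).-1 -> col lo = L r -> row lo = j1 + s ->
    (forall x, (x \in w) =
      ((row x == 0) && (col x <= col hi)) || ((col x == L r) && (0 < row x <= row lo))) ->
    z \notin w -> (forall x, nw x z -> x \in w) ->
  (dist hi z = dist p v2 -> s = 0 /\ z = v2) /\ dist lo z <> dist p v2.
Proof.
move=> rhi chi clo rlo wE nz below.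
have [rz lz Rz] := box_in z; have [g1 g2 g3 g4] := bounds (leq0n r).
have [hj1 hj1' hj1''] := j1_top; have [hj2 hj2' hj2''] := j2_top; have jj := j2_le_j1.
have [rlo' llo Rlo] := box_in lo.
have czmin := col_min z; have czmax := col_max z.
have [d1 d2 d3 d4] := bounds rz.
have left_box : L (row z) < col z -> 0 < row z -> (col z).-1 = L r /\ row z <= row lo.
  move=> h h0; have [x [rx cx]] : exists x, row x = row z /\ col x = (col z).-1 by apply: box_ex; lia.
  have : x \in w by apply: below; rewrite /nw; lia.
  by rewrite wE rx cx; lia.
have up_box i : 0 < i -> i < row z -> L i <= col z -> col z = L r /\ i <= row lo.
  move=> h h0 h1; have R1 : R (row z) <= R i by apply: R_mono; lia.
  have [x [rx cx]] : exists x, row x = i /\ col x = col z by apply: box_ex; lia.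
  have : x \in w by apply: below; rewrite /nw; lia.
  by rewrite wE rx cx; lia.
rewrite wE in nz; rewrite !distE rhi p_row p_col v2_row v2_col.
have [rz0|rz0] := eqVneq (row z) 0.
  have cz : col z = (col hi).+1.
    have [//|nc] := eqVneq (col z) (col hi).+1.
    have [x [rx cx]] : exists x, row x = 0 /\ col x = (col z).-1.
      by apply: box_ex; rewrite ?rz0 in lz Rz *; lia.
    have : x \in w by apply: below; rewrite /nw; lia.
    by rewrite wE rx cx; lia.
  by clear left_box up_box hj1'' hj2'' wE below; split=> [|dE]; lia.
have [cz|cz] := eqVneq (col z) (L r).
  by clear left_box up_box hj1'' hj2'' wE below; split=> [|dE]; lia.
have z_j2 : row z <= j2.
  by rewrite leqNgt; apply/negP => h; have [] := up_box j2; lia.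
have cz' : row z < j2 -> (L r).+1 < col z.
  by move=> h; have := hj2'' (row z); lia.
have cz0 : col z = (L r).+1 \/ col z <= L 0.
  have [h|h] := leqP (col z) (L (row z)); first by right; lia.
  by left; have [] := left_box h; lia.
clear left_box up_box hj1'' hj2'' wE below; split=> dE; last by lia.
have [s0 [rz2 cz2]] : s = 0 /\ row z = j2 /\ col z = (L r).+1 by lia.
by split=> //; apply: box_inj; rewrite ?v2_row ?v2_col.
Qed.

(* The distance from [x1] to [x2] only determines a hook, up to moving boxes from its arm to
   its leg; the distance to the next box removes this ambiguity. *)
Lemma pinned T s1 x1 x2 x3 s2 (m := (R 0).-1 - L 0) :
    word T = s1 ++ x1 :: x2 :: x3 :: s2 -> size s1 = m ->
    dist x1 x2 = dist y1 p -> dist x2 x3 = dist p v2 ->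
  s1 ++ [:: x1; x2; x3] = row0 m ++ [:: y1; p; v2].
Proof.
move=> eT ss d12 d23; have [lT _] := word_lin T.
have [g1 g2 g3 g4] := bounds (leq0n r); have [hj1 hj1' hj1''] := j1_top.
pose w := s1 ++ [:: x1; x2].
have ew : word T = w ++ x3 :: s2 by rewrite eT /w -catA.
have lw : lin nw w by apply: (lin_catl (s2 := x3 :: s2)); rewrite -ew.
have uw := lin_uniq lw.
have [nx3 bx3] := lT _ _ _ ew.
have dw x z : x \in w -> nw z x -> z \in w.
  move=> /mem_cat_split[t1 [t2 e]] zx; have [_ /(_ z zx) zt] := lw _ _ _ e.
  by rewrite e mem_cat zt.
have sw : size w = (R 0 - L 0).+1 by rewrite size_cat ss /m /=; lia.
have x1w : x1 \in w by rewrite mem_cat !inE eqxx orbT.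
have x2w : x2 \in w by rewrite mem_cat !inE eqxx !orbT.
have inc : incomp nw x1 x2.
  move: uw; rewrite /w cat_uniq => /and3P[_ nh /=]; rewrite inE andbT => n12.
  split=> //.
    apply: (lin_consecutive_dist nw_irr cover_dist lw).
    by rewrite d12 distE y1_row y1_col p_row p_col; lia.
  apply/negP => h; have [_ /(_ _ h)] := lw s1 x1 [:: x2] erefl.
  by move=> x2s; move/negP: nh; apply; apply/hasP; exists x2; rewrite // !inE eqxx orbT.
(* If [x2] is the north-east box, it must be [p]. If [x1] is, then [x2] is the foot of the hook and
   its distance to [x3] is excluded. *)
case: (incompP inc) => -[rr cc]; last first.
  have d21 : dist x2 x1 = dist y1 p by rewrite cdistC.
  have [s [e1 e2 e3 e4 wE]] := hook_downset uw dw sw x2w x1w rr cc d21.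
  have [H _] := next_after_hook e1 e2 e3 e4 wE nx3 bx3.
  have [s0 ex3] := H d23; rewrite {}s0 in e2 e4.
  have ex2 : x2 = p by apply: box_inj; lia.
  have ex1 : x1 = y1 by apply: box_inj; lia.
  rewrite {}ex3 {}ex2 {}ex1 in w ew lw uw dw sw x1w x2w wE nx3 bx3 *.
  suff -> : s1 = row0 m by [].
  have Lr := @lin_ext_row0 m (ltac:(rewrite /m; lia)).
  have ls1 : ext [set x | (row x == 0) && (col x < L 0 + m)] s1.
    split; first exact: lin_catl lw.
    move=> x; rewrite inE; have [rx lx Rx] := box_in x; have := wE x.
    rewrite mem_cat !inE.
    have [->|nx1] := eqVneq x y1.
      rewrite (_ : y1 \in s1 = false) ?y1_row; first by lia.
      by apply/negP; have [] := lw _ _ _ (erefl : w = s1 ++ y1 :: [:: p]); move/negP.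
    have [->|nx2] := eqVneq x p.
      rewrite (_ : p \in s1 = false) ?p_row ?p_col; first by rewrite /m; lia.
      by apply/negP => h; move: uw; rewrite cat_uniq /= h !orbT andbF.
    have := box_neq nx1; have := box_neq nx2; rewrite y1_row y1_col p_row p_col !orbF.
    move=> n2 n1 ->; have := hj1'' (row x); rewrite /m; clear - n1 n2 lx wide g3 hj1; lia.
  (* A part of the top row is a chain and has only one linear extension. *)
  apply: (lin_ext_connected nw_irr _ Lr ls1 (P := fun s => s = row0 m)) => //.
  move=> t1 x z t2 /incompP xz Lt _; exfalso.
  have : x \in t1 ++ [:: x, z & t2] by rewrite mem_cat !inE eqxx orbT.
  have : z \in t1 ++ [:: x, z & t2] by rewrite mem_cat !inE eqxx !orbT.
  by rewrite !Lt.2 !inE; lia.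
have [s [e1 e2 e3 e4 wE]] := hook_downset uw dw sw x1w x2w rr cc d12.
by have [_ /(_ d23)] := next_after_hook e1 e2 e3 e4 wE nx3 bx3.
Qed.

Lemma alternating_all : alternating [set: B].
Proof.
have [g1 g2 g3 g4] := bounds (leq0n r).
have [hj1 hj1' hj1''] := j1_top; have [hj2 hj2' hj2''] := j2_top; have jj := j2_le_j1.
pose m := (R 0).-1 - L 0.
have ep : rcons (row0 m) p = row0 m.+1.
  have [h1 h2] : row (box 0 (L 0 + m)) = 0 /\ col (box 0 (L 0 + m)) = L 0 + m.
    by apply: boxP; rewrite /m; lia.
  by rewrite row0S; congr rcons; apply: box_inj; rewrite ?h1 ?h2 ?p_row ?p_col /m; lia.
have row0E x : (x \in rcons (row0 m) p) = (row x == 0).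
  rewrite ep (lin_ext_row0 _).2; last by rewrite /m; lia.
  by rewrite inE; have := col_max x; rewrite /m; lia.
pose K1 := y1 |: [set x in rcons (row0 m) p].
have K1E x : (x \in K1) = (x == y1) || (row x == 0) by rewrite !inE -row0E.
have y1E x : (x == y1) = (row x == j1) && (col x == L r).
  apply/eqP/andP => [->|[/eqP h1 /eqP h2]]; first by rewrite y1_row y1_col.
  by apply: box_inj; rewrite ?y1_row ?y1_col.
(* Below the top row, column [L r] begins with [y1], so this stage consists of the top row, [y1] and
   [v2]. *)
apply: alternating_stages; rewrite (_ : stage _ _ = v2 |: K1); last first.
  apply/setP => x; rewrite in_setU1 K1E y1E !inE; have cx := col_min x.
  have [rx lx Rx] := box_in x; have := hj1'' (row x).
  by case: (x == v2); rewrite ?orbT //=; lia.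
have iK1 : ideal nw K1.
  move=> x z; rewrite !K1E !y1E => xK /nwP xz; have cz := col_min z.
  by have [rz lz Rz] := box_in z; have := hj1'' (row z); lia.
have aK1 : addable K1 v2.
  split=> [|z /nwP]; first by rewrite K1E y1E v2_row v2_col; lia.
  rewrite K1E y1E v2_row v2_col => zv; have cz := col_min z.
  by have [rz lz Rz] := box_in z; have := hj1'' (row z); have := hj2'' (row z); lia.
have Ls0 := @lin_ext_row0 m (ltac:(rewrite /m; lia)).
have ay : addable [set x | (row x == 0) && (col x < L 0 + m)] y1.
  split=> [|z /nwP]; first by rewrite inE y1_row; lia.
  rewrite inE y1_row y1_col => zy; have cz := col_min z.
  by have [rz lz Rz] := box_in z; have := hj1'' (row z); rewrite /m; lia.
have Ls1 := lin_ext_rcons Ls0 ay.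
have ap : addable (y1 |: [set x | (row x == 0) && (col x < L 0 + m)]) p.
  split=> [|z /nwP]; first by rewrite in_setU1 y1E inE p_row p_col /m; lia.
  rewrite in_setU1 y1E inE p_row p_col /m => zp.
  by have [rz lz Rz] := box_in z; lia.
have Ls2 := lin_ext_rcons Ls1 ap.
have eK : p |: (y1 |: [set x | (row x == 0) && (col x < L 0 + m)]) = K1.
  apply/setP => x; rewrite in_setU1 in_setU1 K1E inE.
  have -> : (x == p) = (row x == 0) && (col x == (R 0).-1).
    apply/eqP/andP => [->|[/eqP h1 /eqP h2]]; first by rewrite p_row p_col.
    by apply: box_inj; rewrite ?p_row ?p_col.
  by case: (x == y1); rewrite ?orbT //=; have := col_max x; rewrite /m; lia.
rewrite eK in Ls2; have Ls3 := lin_ext_rcons Ls2 aK1.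
apply: (alternating_base nw_irr nw_trans incomp_dist cover_dist word_inj swapsG iK1 aK1).
- have e3 : rcons (rcons (rcons (row0 m) y1) p) v2 = row0 m ++ [:: y1; p; v2].
    by rewrite -!cats1 -!catA.
  by rewrite e3 in Ls3.
- split; rewrite 1?eq_sym ?y1E /nw ?y1_row ?y1_col ?p_row ?p_col; lia.
- split; rewrite /nw ?v2_row ?v2_col ?p_row ?p_col; [|by lia|by lia].
  by apply/eqP => e; have := v2_row; rewrite -e p_row; lia.
- by rewrite !distE y1_row y1_col p_row p_col v2_row v2_col; lia.
- move=> x [xK xmax]; move: xK; rewrite K1E => /predU1P[->|/eqP rx]; [by right|left].
  have pK : p \in K1 by rewrite K1E p_row orbT.
  have := xmax p pK; have := col_max x; rewrite /nw p_row p_col => h1 h2.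
  by apply: box_inj; rewrite ?p_row ?p_col; lia.
- move=> t1 x z t2; rewrite ep; apply: row0_dist; rewrite /m; lia.
- by move=> x z; rewrite !row0E => /eqP rx /eqP rz /incompP; lia.
- move=> T s1 x1 x2 x3 s2 e ss d12 d23; apply: pinned e _ d12 d23.
  by rewrite ss size_map size_iota.
Qed.

End Shape.

Lemma skew_three_cycles (B : finType) (row col : B -> nat) (r : nat) (L R : nat -> nat)
    (X : finType) (G : {group {perm X}}) (word : X -> seq B) :
    (forall x y, row x = row y -> col x = col y -> x = y) ->
    (forall x, [/\ row x <= r, L (row x) <= col x & col x < R (row x)]) ->
    (forall i j, i <= r -> L i <= j -> j < R i -> exists x, row x = i /\ col x = j) ->
    (forall i j, i <= j -> j <= r -> L j <= L i) ->
    (forall i j, i <= j -> j <= r -> R j <= R i) ->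
    L 0 + r + 2 <= R r -> 1 < r ->
    injective word -> (forall T, lin_ext (nw row col) [set: B] (word T)) ->
    (forall t a, 1 < a -> exists2 u, u \in G &
      forall T, word (u T) = swap_at (content row col) t a (word T)) ->
  forall T1 T2 T3 : X, uniq [:: T1; T2; T3] -> (tperm T1 T2 * tperm T1 T3 \in G)%g.
Proof.
move=> inj inn ex Lm Rm wide r1 winj wlin swaps.
have [b1 b2] : L r <= L 0 /\ R r <= R 0 by split; [apply: Lm|apply: Rm].
have [p [p1 p2]] : exists x, row x = 0 /\ col x = (R 0).-1 by apply: ex; lia.
have r0 : 0 < r by lia.
have [j1 j1P] := top_exists r0 (leqnn (L r)); have [j2 j2P] := top_exists r0 (leqnSn (L r)).
have [y1 [y11 y12]] : exists x, row x = j1 /\ col x = L r.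
  case: j1P => h1 h2 _; have Rj : R r <= R j1 by apply: Rm; lia.
  by apply: ex; lia.
have [v2 [v21 v22]] : exists x, row x = j2 /\ col x = (L r).+1.
  case: j2P => h1 h2 _; have Rj : R r <= R j2 by apply: Rm; lia.
  by apply: ex; lia.
apply: (alternating_full winj wlin).
by apply: (@alternating_all B row col r L R inj inn ex Lm Rm wide r1 X G word winj wlin swaps p y1 v2 j1 j2).
Qed.

(** * Standard tableaux *)

Section Tableaux.
Context (g r d : nat) (alpha beta : nat -> nat).
Hypothesis ram_a : ram_seq r d alpha.
Hypothesis ram_b : ram_seq r d beta.
Hypothesis r_gt1 : 1 < r.
Hypothesis full : r.+1 < alpha r + beta r + (g + r - d).

Local Notation boxT := (boxT g r d alpha beta).
Local Notation YT := (YT g r d alpha beta).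
Local Notation filling := (filling g r d alpha beta).

Definition cell : finType := {b : boxT | isbox b}.
Implicit Types (x y : cell) (T : YT).

(** Rows are counted from 0 from here on, and [rend] is the first column after the end of the
    row. *)
Definition crow x : nat := (val x).1.-1.
Definition ccol x : nat := (val x).2.
Definition lend i := (alpha 0 - alpha (r - i)).+1.
Definition rend i := (alpha 0 + mm g r d + beta i).+1.

Lemma ram_mono (a : nat -> nat) i j : ram_seq r d a -> i <= j -> j <= r -> a j <= a i.
Proof.
case=> _ [_ step]; elim: j => [|j IH]; first by rewrite leqn0 => /eqP->.
rewrite leq_eqVlt => /predU1P[->//|ij] jr.
by apply: leq_trans (step _ jr) (IH _ _); lia.
Qed.

Lemma lend_mono i j : i <= j -> j <= r -> lend j <= lend i.
Proof.
move=> ij jr; rewrite /lend ltnS; apply: leq_sub2l.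
by apply: (ram_mono ram_a); lia.
Qed.

Lemma rend_mono i j : i <= j -> j <= r -> rend j <= rend i.
Proof. by move=> ij jr; rewrite /rend ltnS leq_add2l; apply: (ram_mono ram_b). Qed.

(** The number of full columns is $\alpha_r+\beta_r+m$, which [full] bounds below by $r+2$. *)
Lemma lend_rend : lend 0 + r + 2 <= rend r.
Proof.
have := ram_mono ram_a (leq0n r) (leqnn r); move: full.
by rewrite /lend /rend /mm subn0; lia.
Qed.

Lemma cell_row x : (val x).1 = (crow x).+1 :> nat.
Proof. by have /andP[/andP[h _] _] := valP x; rewrite /crow; lia. Qed.

Lemma cell_in x : [/\ crow x <= r, lend (crow x) <= ccol x & ccol x < rend (crow x)].
Proof.
have := valP x; rewrite /isbox /inshape cell_row /= /lend /rend /ccol subSS => /andP[h1 /andP[h2 h3]].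
by split.
Qed.

Lemma cell_inj x y : crow x = crow y -> ccol x = ccol y -> x = y.
Proof.
move=> e1 e2; apply/val_inj; rewrite [val x]surjective_pairing [val y]surjective_pairing.
by congr (_, _); apply/val_inj; rewrite //= !cell_row e1.
Qed.

Lemma cell_ex i j : i <= r -> lend i <= j -> j < rend i -> exists x, crow x = i /\ ccol x = j.
Proof.
move=> ir lj jr; have ri : i.+1 < nrows r by rewrite /nrows; lia.
have cj : j < ncols g r d alpha beta.
  by apply: leq_trans jr (rend_mono (leq0n i) ir).
have bx : isbox ((Ordinal ri, Ordinal cj) : boxT).
  by rewrite /isbox /inshape /= subSS; move: lj jr; rewrite /lend /rend; lia.
by exists (Sub _ bx); rewrite /crow /ccol SubK.
Qed.

Local Notation cnw := (nw crow ccol).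
Local Notation ccontent := (content crow ccol).

Lemma standardP (F : filling) : reflect
  [/\ forall q, ~~ isbox q -> F q = 0 :> nat, forall x, 0 < F (val x),
      forall x y, F (val x) = F (val y) :> nat -> x = y,
      forall e, 0 < e <= g -> exists x, F (val x) = e :> nat &
      forall x y, (crow x = crow y /\ ccol x < ccol y) \/ (ccol x = ccol y /\ crow x < crow y) ->
        F (val x) < F (val y)] (standardb F).
Proof.
apply: (iffP idP).
  case/and5P=> /forallP h1 /forallP h2 /forallP h3 /forallP h4 /andP[/forallP h5 /forallP h6]; split.
  - by move=> q nq; apply/eqP; have := h1 q; rewrite nq.
  - by move=> x; have := h2 (val x); rewrite (valP x).
  - move=> x y e; apply/val_inj/eqP; move/forallP: (h3 (val x)) => /(_ (val y)).
    by rewrite !(valP x, valP y) /= => /implyP; apply; apply/eqP/val_inj.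
  - move=> e he; have eg : e < g.+1 by lia.
    have := h4 (Ordinal eg); rewrite /= => /implyP/(_ _)/existsP[|q /andP[bq /eqP Fq]]; first by lia.
    by exists (Sub q bq); rewrite SubK Fq.
  - move=> x y [[e lt]|[e lt]].
    + move/forallP: (h5 (val x)) => /(_ (val y)); rewrite !(valP x, valP y) /= !cell_row e eqxx.
      by move=> /implyP; apply.
    + move/forallP: (h6 (val x)) => /(_ (val y)); rewrite !(valP x, valP y) /= -!/(ccol _) e eqxx.
      by move=> /implyP; apply; rewrite /= !cell_row.
case=> h1 h2 h3 h4 h5; apply/and5P; split; last (apply/andP; split); apply/forallP => q.
- by apply/implyP => /h1->.
- by apply/implyP => bq; have := h2 (Sub q bq); rewrite SubK.
- apply/forallP => q'; apply/implyP => /andP[/andP[bq bq'] /eqP e].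
  by have := h3 (Sub q bq) (Sub q' bq'); rewrite !SubK e => /(_ erefl) /(congr1 val); rewrite !SubK => ->.
- apply/implyP => q0; have [|x e] := h4 q; first by have := ltn_ord q; lia.
  by apply/existsP; exists (val x); rewrite (valP x); apply/eqP/val_inj.
- apply/forallP => q'; apply/implyP => /andP[/andP[/andP[bq bq'] /eqP e] lt].
  have := h5 (Sub q bq) (Sub q' bq'); rewrite /crow /ccol !SubK e; apply; by left.
- apply/forallP => q'; apply/implyP => /andP[/andP[/andP[bq bq'] /eqP e] lt].
  have := h5 (Sub q bq) (Sub q' bq'); rewrite -!/(crow _) /ccol !SubK e; apply; right; split=> //.
  by have := cell_row (Sub q bq); have := cell_row (Sub q' bq'); rewrite !SubK; lia.
Qed.

Definition entry T x : nat := val T (val x).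

(** Monotonicity passes from rows and columns to the order [nw] through the box in the row of [x]
    and the column of [y], which lies in the diagram. *)
Lemma entryP T :
  [/\ forall x, 0 < entry T x <= g, injective (entry T),
      forall e, 0 < e <= g -> exists x, entry T x = e &
      forall x y, cnw x y -> entry T x < entry T y].
Proof.
have [_ pos inj surj mono] := standardP _ (valP T); split.
- by move=> x; rewrite /entry pos -ltnS ltn_ord.
- exact: inj.
- exact: surj.
move=> x y xy; have [rx lx Rx] := cell_in x; have [ry ly Ry] := cell_in y.
move/and3P: xy => [h1 h2 h3].
have Lyx := lend_mono h1 ry; have Ryx := rend_mono h1 ry.
have [z [rz cz]] : exists z, crow z = crow x /\ ccol z = ccol y by apply: cell_ex; lia.
have xz : ccol x < ccol y -> entry T x < entry T z by move=> h; apply: mono; lia.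
have zy : crow x < crow y -> entry T z < entry T y by move=> h; apply: mono; lia.
have [e|ne] := eqVneq (crow x) (crow y).
  have <- : z = y by apply: cell_inj; lia.
  by apply: xz; lia.
have [e'|ne'] := eqVneq (ccol x) (ccol y).
  have -> : x = z by apply: cell_inj; lia.
  by apply: zy; lia.
by apply: (ltn_trans (xz _) (zy _)); lia.
Qed.

(** The inverse of the filling, read in the order $1,\dots,g$; every entry occurs, so [pmap] drops
    nothing. *)
Definition word T : seq cell := pmap (fun e => [pick x | entry T x == e]) (iota 1 g).

Lemma word_entries T : map (entry T) (word T) = iota 1 g.
Proof.
have [_ _ surj _] := entryP T; rewrite /word.
have : {subset iota 1 g <= [pred e | 0 < e <= g]} by move=> e; rewrite mem_iota inE; lia.
elim: (iota 1 g) => //= e s IH sub.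
have [|x ex] := surj e; first by apply: sub; rewrite mem_head.
case: pickP => [y /eqP ey|/(_ x)]; last by rewrite ex eqxx.
by rewrite /= ey IH // => e' es; apply: sub; rewrite inE es orbT.
Qed.

Lemma word_unique T s : map (entry T) s = iota 1 g -> word T = s.
Proof. by have [_ inj _ _] := entryP T; rewrite -(word_entries T) => /(inj_map inj). Qed.

Lemma mem_word T x : x \in word T.
Proof.
have [bnd inj _ _] := entryP T.
by rewrite -(mem_map inj) word_entries mem_iota; have := bnd x; lia.
Qed.

Lemma size_word T : size (word T) = g.
Proof. by rewrite -(size_map (entry T)) word_entries size_iota. Qed.

Lemma entry_cat T s1 x s2 : word T = s1 ++ x :: s2 -> entry T x = (size s1).+1.
Proof.
move=> e; have := congr1 (fun s => nth 0 s (size s1)) (word_entries T).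
rewrite e map_cat nth_cat size_map ltnn subnn /= nth_iota ?add1n //.
by have := size_word T; rewrite e size_cat /=; lia.
Qed.

Lemma word_inj : injective word.
Proof.
move=> T T' e; apply/val_inj/ffunP => q; apply/val_inj.
have [bq|nq] := boolP (isbox q); last first.
  have [z _ _ _ _] := standardP _ (valP T); have [z' _ _ _ _] := standardP _ (valP T').
  by rewrite /= z ?z'.
have := mem_word T (Sub q bq) => /mem_cat_split[s1 [s2 es]].
have := entry_cat es; rewrite e in es; rewrite -(entry_cat es) /entry SubK; exact.
Qed.

Lemma word_lin T : lin_ext cnw [set: cell] (word T).
Proof.
split=> [s1 x s2 es|x]; last by rewrite mem_word inE.
have [_ inj _ mono] := entryP T.
have uw : uniq (word T) by rewrite -(map_inj_uniq inj) word_entries iota_uniq.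
split.
  by apply/negP => xs; move: uw; rewrite es uniq_catC /= mem_cat xs orbT.
move=> y /mono; rewrite (entry_cat es) => lt.
have [t1 [t2 et]] := mem_cat_split (mem_word T y).
rewrite (entry_cat et) in lt.
have : y \in take (size s1) (word T).
  have h : size (rcons t1 y) <= size s1 by rewrite size_rcons; lia.
  by rewrite et -cat_rcons take_cat ltnNge h /= mem_cat mem_rcons mem_head.
by rewrite es take_size_cat.
Qed.

(** * The generators as exchanges of letters *)

Definition swapn t e := if e == t then t.+1 else if e == t.+1 then t else e.

Lemma swapnP t e : (e = t /\ swapn t e = t.+1) \/ (e = t.+1 /\ swapn t e = t) \/
  (e <> t /\ e <> t.+1 /\ swapn t e = e).
Proof. by rewrite /swapn; case: eqP => h; last case: eqP => h'; auto. Qed.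

Lemma swap_entriesE (F : filling) t q : t < g -> swap_entries t F q = swapn t (F q) :> nat.
Proof.
move=> tg; rewrite ffunE /swapn; case: eqP => _; first by rewrite inordK.
by case: eqP => _; rewrite ?inordK //; lia.
Qed.

Lemma swapnK t : involutive (swapn t).
Proof. by move=> e; have := swapnP t e; have := swapnP t (swapn t e); lia. Qed.

Lemma cell_incompP x y : incomp cnw x y ->
  (crow x < crow y /\ ccol y < ccol x) \/ (crow y < crow x /\ ccol x < ccol y).
Proof. exact: (incompP cell_inj). Qed.

(** For incomparable boxes the row and column differences have opposite signs, so the grid distance
    is the difference of contents. Comparable boxes in different rows and columns cannot carry [t]
    and [t + 1], since a corner of their rectangle would need an entry strictly between. *)
Lemma swap_condP T t a : reflect
  (exists x y, [/\ entry T x = t, entry T y = t.+1, incomp cnw x y & cdist ccontent x y = a])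
  (swap_cond t a (val T)).
Proof.
have [bnd inj surj mono] := entryP T.
apply: (iffP idP) => [/existsP[q /existsP[q' /and5P[bq bq' /eqP e /eqP e' /and3P[nr nc /eqP dq]]]]|].
  have [x ex] : exists x, val x = q by exists (Sub q bq); rewrite SubK.
  have [y ey] : exists y, val y = q' by exists (Sub q' bq'); rewrite SubK.
  rewrite -ex -ey !cell_row in nr nc e e' dq; rewrite -/(ccol x) -/(ccol y) in nc dq.
  exists x, y; have inc : incomp cnw x y.
    split.
    - by apply: contraNneq nr => ->.
    - apply/negP => xy; have [rx lx Rx] := cell_in x; have [ry ly Ry] := cell_in y.
      move/and3P: (xy) => [h1 h2 h3].
      have Lyx := lend_mono h1 ry; have Ryx := rend_mono h1 ry.
      have [z [rz cz]] : exists z, crow z = crow x /\ ccol z = ccol y by apply: cell_ex; lia.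
      have := mono x z; have := mono z y; rewrite /entry e e' /nw rz cz; lia.
    - by apply/negP => /mono; rewrite /entry e e'; lia.
  split=> //; rewrite distE -dq /distn'.
  by have := cell_incompP inc; lia.
case=> x [y [ex ey inc dxy]]; apply/existsP; exists (val x); apply/existsP; exists (val y).
rewrite (valP x) (valP y) -/(entry T x) -/(entry T y) ex ey !eqxx !cell_row -/(ccol x) -/(ccol y) /=.
by have := cell_incompP inc; move: dxy; rewrite distE /distn'; lia.
Qed.

Lemma swap_standard T t a : 0 < t < g -> swap_cond t a (val T) ->
  standardb (swap_entries t (val T)).
Proof.
move=> tg /swap_condP[x0 [y0 [ex ey /cell_incompP inc _]]].
have [bnd inj surj mono] := entryP T; have [z0 _ _ _ smono] := standardP _ (valP T).
have tg' : t < g by lia.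
have swE x : swap_entries t (val T) (val x) = swapn t (entry T x) :> nat by rewrite swap_entriesE.
apply/standardP; split=> [q nq|x|x y|e he|x y].
- by rewrite swap_entriesE // z0 //; have := swapnP t 0; lia.
- by rewrite swE; have := bnd x; have := swapnP t (entry T x); lia.
- by rewrite !swE => /(can_inj (swapnK t))/inj.
- have [|x e'] := surj (swapn t e); first by have := swapnP t e; lia.
  by exists x; rewrite swE e' swapnK.
move=> xy; have := smono x y xy; rewrite !swE -/(entry T x) -/(entry T y).
have : ~ (entry T x = t /\ entry T y = t.+1).
  case=> h1 h2; have e1 : x = x0 by apply: inj; rewrite h1.
  have e2 : y = y0 by apply: inj; rewrite h2.
  by move: xy; rewrite e1 e2; lia.
by have := swapnP t (entry T x); have := swapnP t (entry T y); lia.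
Qed.

(** For [0 < t < g] the exchanged filling is standard by [swap_standard], and [insubd] does not fall
    back on its default [T]. *)
Definition swap_tableau t a T : YT :=
  if swap_cond t a (val T) then insubd T (swap_entries t (val T)) else T.

Lemma val_swap_tableau t a T : 0 < t < g -> val (swap_tableau t a T) =
  if swap_cond t a (val T) then swap_entries t (val T) else val T.
Proof.
rewrite /swap_tableau => tg; case: ifP => // sc.
by rewrite insubdK //; apply: swap_standard sc.
Qed.

Lemma entry_swap_tableau t a T x : 0 < t < g -> entry (swap_tableau t a T) x =
  if swap_cond t a (val T) then swapn t (entry T x) else entry T x.
Proof.
move=> tg; rewrite /entry val_swap_tableau //; case: ifP => // _.
by rewrite swap_entriesE //; lia.
Qed.

Lemma swap_tableauK t a : 0 < t < g -> involutive (swap_tableau t a).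
Proof.
move=> tg T; have [sc|sc] := boolP (swap_cond t a (val T)); last first.
  by rewrite /swap_tableau !(negbTE sc).
have sc' : swap_cond t a (val (swap_tableau t a T)).
  have /swap_condP[x [y [ex ey [n1 n2 n3] dxy]]] := sc.
  apply/swap_condP; exists y, x; rewrite cdistC !entry_swap_tableau // sc ex ey.
  rewrite /swapn !eqxx; split=> //; last by split=> //; rewrite eq_sym.
  by case: eqP => //; lia.
apply/val_inj/ffunP => q; apply: ord_inj.
have tg' : t < g by lia.
rewrite (val_swap_tableau a (swap_tableau t a T) tg) sc' swap_entriesE //.
by rewrite val_swap_tableau // sc swap_entriesE // swapnK.
Qed.

(** Entry [t + 1] stands at position [t] of the word, hence the shift. Consecutive letters at
    distance [a > 1] do not form a cover, so they are incomparable and satisfy the condition of the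
    generator. *)
Lemma word_swap_tableau t a T : 1 < a -> t.+1 < g ->
  word (swap_tableau t.+1 a T) = swap_at ccontent t a (word T).
Proof.
move=> a1 tg; have tg' : 0 < t.+1 < g by [].
have [bnd inj surj mono] := entryP T; have ws := word_entries T.
case: (swap_atP ccontent t a (word T)) => [s1 x y s2 ss e dxy|s1 x y s2 ss e dxy|]; last first.
- by rewrite size_word; lia.
- rewrite /swap_tableau ifN //; apply/swap_condP => -[x' [y' [ex ey _ dxy']]].
  have e1 := entry_cat e; have := e; rewrite -cat_rcons => /entry_cat; rewrite size_rcons => e2.
  have xx : x' = x by apply: inj; rewrite e1 ss.
  have yy : y' = y by apply: inj; rewrite e2 ss.
  by rewrite -xx -yy dxy' eqxx in dxy.
have e1 := entry_cat e; have := e; rewrite -cat_rcons => /entry_cat; rewrite size_rcons => e2.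
have lw := (word_lin T).1; rewrite e in lw.
have sc : swap_cond t.+1 a (val T).
  apply/swap_condP; exists x, y; rewrite e1 e2 ss; split=> //; split.
  - by apply/eqP => exy; rewrite exy e2 in e1; lia.
  - apply: (lin_consecutive_dist (c := ccontent) (nw_irr crow ccol) _ lw); last by rewrite dxy.
    by move=> u v; apply: (cover_dist cell_in cell_ex lend_mono rend_mono).
  - by apply/negP => /mono; rewrite e1 e2; lia.
apply: word_unique; rewrite -ws e !map_cat /=.
have uw : uniq (word T) by apply: lin_uniq (word_lin T).1.
have [nx ny] : x \notin s1 ++ s2 /\ y \notin s1 ++ s2.
  move: uw; rewrite e (uniq_catCA s1 [:: x; y] s2) /= inE negb_or.
  by case/and3P=> /andP[].
have off z : z \in s1 ++ s2 -> entry (swap_tableau t.+1 a T) z = entry T z.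
  move=> zs; rewrite entry_swap_tableau // sc /swapn.
  case: eqP => [ez|_]; first by rewrite -(inj z x) ?zs // ez e1 ss in nx.
  by case: eqP => [ez|//]; rewrite -(inj z y) ?zs // ez e2 ss in ny.
rewrite !entry_swap_tableau // sc e1 e2 ss /swapn !eqxx.
congr (_ ++ _).
  by apply/eq_in_map => z zs; apply: off; rewrite mem_cat zs.
have -> : (t.+2 == t.+1) = false by lia.
congr [:: _, _ & _].
by apply/eq_in_map => z zs; apply: off; rewrite mem_cat zs orbT.
Qed.

(** Where no generator is listed, for [t] beyond the end of the word or [a] above every difference
    of contents, the exchange is the identity. *)
Lemma EH_swaps t a : 1 < a -> exists2 u, u \in EH g r d alpha beta &
  forall T, word (u T) = swap_at ccontent t a (word T).
Proof.
move=> a1; have id_case : (forall T, swap_at ccontent t a (word T) = word T) ->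
    exists2 u, u \in EH g r d alpha beta & forall T, word (u T) = swap_at ccontent t a (word T).
  by move=> H; exists 1%g; [exact: group1|move=> T; rewrite perm1 H].
have [tg|gt] := ltnP t.+1 g; last by apply: id_case => T; rewrite swap_at_small ?size_word.
have [ab|ba] := ltnP a (nrows r + ncols g r d alpha beta); last first.
  apply: id_case => T; case: (swap_atP ccontent t a (word T)) => // s1 x y s2 _ _ dxy.
  have [rx lx Rx] := cell_in x; have [ry ly Ry] := cell_in y.
  have bx := rend_mono (leq0n _) rx; have b_y := rend_mono (leq0n _) ry.
  move: dxy ba; rewrite distE /nrows /ncols; move: bx b_y Rx Ry; rewrite /rend; lia.
have tg' : 0 < t.+1 < g by [].
exists (perm (can_inj (swap_tableauK a tg'))); last first.
  by move=> T; rewrite permE word_swap_tableau.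
apply: mem_gen; rewrite inE; apply/existsP; exists (Ordinal tg).
apply/existsP; exists (Ordinal ab); rewrite /= (ltnW a1) /=.
by apply/forallP => T; rewrite permE val_swap_tableau.
Qed.

Lemma EH_Alt_or_Sym :
  EH g r d alpha beta = ('Alt_YT)%g \/ EH g r d alpha beta = ('Sym_YT)%g.
Proof.
have := @Alt_or_Sym _ [group of EH g r d alpha beta]; apply.
exact: (skew_three_cycles cell_inj cell_in cell_ex lend_mono rend_mono lend_rend
  r_gt1 word_inj word_lin EH_swaps).
Qed.

End Tableaux.

Theorem theorem4p5 (g r d : nat) (alpha beta : nat -> nat) :
  ram_seq r d alpha -> ram_seq r d beta ->
  d <= g + r ->
  rho g r d alpha beta = 0%R ->
  2 <= r ->
  r.+1 < alpha r + beta r + (g + r - d) ->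
  (* (1) *)
  (forall j, j < r ->
     (Posz (maxn (alpha 0%N - alpha r) 1) <
        (alpha (r - j - 1)%N)%:Z + (beta j)%:Z + g%:Z - d%:Z)%R) ->
  (* (2) *)
  (\sum_(i < r.+1) ((alpha i)%:Z - (alpha r)%:Z) <
     (alpha r)%:Z + g%:Z - d%:Z + r%:Z + (beta r)%:Z)%R ->
  (* (3) *)
  (forall i j, i < r -> i <= j < r -> i + j + 1 <= r ->
     ((alpha (r - i)%N)%:Z + (beta i)%:Z - 1 <
        (alpha (r - i - j - 1)%N)%:Z + (beta j)%:Z)%R) ->
  (* (4) *)
  (forall i, 0 < i < r ->
     alpha (r - i) + beta i = alpha (r - 1) + beta 1 /\
     alpha r + beta 0 <= alpha (r - 1) + beta 1) ->
  EH g r d alpha beta = ('Alt_(YT g r d alpha beta))%g \/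
  EH g r d alpha beta = ('Sym_(YT g r d alpha beta))%g.
Proof.
move=> ram_a ram_b _ _ r_gt1 full _ _ _ _.
exact: EH_Alt_or_Sym ram_a ram_b r_gt1 full.
Qed.
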